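(* Let $0<q<1$, $M\ge1$, $\vec k=(k_1,\dots,k_M)$ with all $k_i>0$, $s,t>-1$, $v\in\mathbb{C}$ with $\mathrm{Re}(v)<1+s+t$, and $\vec x,\vec y\in(\mathbb{Z}_{\ge0})^M$. Then for every $j=1,\dots,M$, $P_{\mathrm r}(\vec x,\vec y)=P_{\mathrm r}(\vec x,\vec y;s,t,v,\vec k;q)$ satisfies $$\{h'_M(\vec x,s)\}_q\sum_{\vec\varepsilon\in\mathcal{E}_j}C^{(j)}_{\vec\varepsilon}(\vec y,t)P_{\mathrm r}(\vec x,\vec y+\vec\varepsilon)=\{h'_{M-j}(\vec x,s)\}_qP_{\mathrm r}(\vec x,\vec y)+\sum_{\vec\varepsilon\in\mathcal{E}_j}D^{(j)}_{\vec\varepsilon}(\vec y,t)P_{\mathrm r}(\vec x,\vec y+\vec\varepsilon),$$ where in both sums only those $\vec\varepsilon$ with $\vec y+\vec\varepsilon\in(\mathbb{Z}_{\ge0})^M$ are included.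
   Context: $q^z=e^{z\log q}$; $\{z\}_q=\frac{q^z+q^{-z}}{q+q^{-1}}$; $(\alpha;p)_n=\prod_{i=0}^{n-1}(1-\alpha p^i)$, $(\alpha_1,\dots,\alpha_m;p)_n=\prod_i(\alpha_i;p)_n$. For $k>0$ and $n,x\in\mathbb{Z}_{\ge0}$, $$\phi_{u,s}(n,x;k)=q^{n(s-u+\frac12k+\frac12)}\sum_{l=0}^{\min(n,x)}\frac{(q^{2n},\,q^{2x},\,q^{-2x-2s-2k};q^{-2})_l}{(q^{-2k},\,q^{-2};q^{-2})_l}q^{-2l},\qquad w_k(n)=q^{-n(k-1)}\frac{(q^{2k};q^2)_n}{(q^2;q^2)_n}.$$ Height function: $h'_i(\vec y,t)=t+\sum_{l=1}^i(2y_l+k_l)$, $h'_0(\vec y,t)=t$. Then $\Phi_{v,t}(\vec n,\vec y)=\prod_{i=1}^M\phi_{v,h'_{i-1}(\vec y,t)}(n_i,y_i;k_i)$ and $$P_{\mathrm r}(\vec x,\vec y;s,t,v,\vec k;q)=\sum_{\vec n\in(\mathbb{Z}_{\ge0})^M}\Phi_{1,s}(\vec n,\vec x)\Phi_{v,t}(\vec n,\vec y)\prod_{i=1}^Mw_{k_i}(n_i)\qquad(\mathrm{Re}(v)<1+s+t).$$ Index set: $\mathcal{E}_j$ is the set of $\vec\varepsilon\in\{0,\pm1,\pm2\}^M$ with $\varepsilon_i=0$ for $i=1,\dots,M-j$ and $\sum_{i=1}^\ell\varepsilon_i\in\{-1,0,1\}$ for $\ell=1,\dots,M$. Univariate coefficients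 $c_{\varepsilon,m}(y,t;k)$, $m\in\{0,2,-2\}$: $$c_{-1,0}=\frac{q^{-4y-2t-3k+2}(1-q^{-2y})(1-q^{-2y-2t})}{(1-q^{-4y-2t-2k+2})(1-q^{-4y-2t-2k})},\quad c_{1,0}=\frac{q^k(1-q^{-2y-2k})(1-q^{-2y-2t-2k})}{(1-q^{-4y-2t-2k})(1-q^{-4y-2t-2k-2})},\quad c_{0,0}=q^k-c_{-1,0}-c_{1,0},$$ $$c_{-2,2}=\frac{q^k(1-q^{2y})(1-q^{2y-2})}{(1-q^{4y+2t+2k})(1-q^{4y+2t+2k-2})},\quad c_{-1,2}=\frac{q^k(1+q^2)(1-q^{2y})(1-q^{-2y-2k-2t})}{(1-q^{4y+2t+2k+2})(1-q^{-4y-2k-2t+2})},\quad c_{0,2}=\frac{q^k(1-q^{-2y-2k-2t})(1-q^{-2y-2k-2t-2})}{(1-q^{-4y-2k-2t})(1-q^{-4y-2k-2t-2})},$$ $$c_{0,-2}=\frac{q^k(1-q^{2y+2t})(1-q^{2y+2t-2})}{(1-q^{4y+2t+2k})(1-q^{4y+2t+2k-2})},\quad c_{1,-2}=\frac{q^k(1+q^2)(1-q^{-2y-2k})(1-q^{2y+2t})}{(1-q^{-4y-2k-2t+2})(1-q^{4y+2t+2k+2})},\quad c_{2,-2}=\frac{q^k(1-q^{-2y-2k})(1-q^{-2y-2k-2})}{(1-q^{-4y-2k-2t})(1-q^{-4y-2k-2t-2})}.$$ For $y=0$: $c_{-1,0}=0$, and identical factors in numerator and denominator of $c_{1,0}$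 and $c_{0,2}$ are cancelled. Multivariate coefficients: $$C^{(j)}_{\vec\varepsilon}(\vec y,t)=\prod_{i=M-j+1}^Mc_{\varepsilon_i,m_i}\big(y_i,h'_{i-1}(\vec y,t);k_i\big),\qquad m_i=2\sum_{l=1}^{i-1}\varepsilon_l,$$ and, with $\sigma=\sum_{i=1}^M\varepsilon_i$, $D^{(j)}_{\vec\varepsilon}(\vec y,t)$ equals - $C^{(j)}_{\vec\varepsilon}(\vec y,t)\{h'_M(\vec y,t)+v-1\}_q$ if $\sigma=-1$; - $C^{(j)}_{\vec\varepsilon}(\vec y,t)\{h'_M(\vec y,t)\}_q\{v\}_q-\{h'_{M-j}(\vec y,t)\}_q\{v\}_q$ if $\vec\varepsilon=0$; - $C^{(j)}_{\vec\varepsilon}(\vec y,t)\{h'_M(\vec y,t)\}_q\{v\}_q$ if $\sigma=0$, $\vec\varepsilon\neq0$; - $C^{(j)}_{\vec\varepsilon}(\vec y,t)\{h'_M(\vec y,t)-v+1\}_q$ if $\sigma=1$. *)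

(* Defs.v *)
From HB Require Import structures.
From mathcomp Require Import all_boot all_order all_algebra.
From mathcomp Require Import complex.
From mathcomp Require Import reals.
From mathcomp.analysis Require Import topology normedtype sequences exp trigo.
From mathcomp.analysis.showcase Require Import summability.

Set Implicit Arguments.
Unset Strict Implicit.
Unset Printing Implicit Defensive.

Import Order.TTheory GRing.Theory Num.Theory.
Import numFieldNormedType.Exports.

Local Open Scope ring_scope.
Local Open Scope complex_scope.

(* Throughout, vectors indexed by 1, ..., M are functions on 'I_M, so the
   component written x_i on paper (1 <= i <= M) is the one at ordinal i - 1. *)

Definition cexp (R : realType) (z : R[i]) : R[i] :=
  (expR (complex.Re z))%:C *
  (cos (complex.Im z) +i* sin (complex.Im z)).

(* q^z for a complex exponent z; real exponents are handled by powR, which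
   agrees with it for q > 0. *)
Definition cpow (R : realType) (q : R) (z : R[i]) : R[i] :=
  cexp (z * (ln q)%:C).

Definition qbrace (R : realType) (q : R) (z : R[i]) : R[i] :=
  (cpow q z + cpow q (- z)) / (q + q^-1)%:C.

Definition qpoch (R : realType) (a p : R) (n : nat) : R :=
  \prod_(i < n) (1 - a * p ^+ i).

Definition phi (R : realType) (q : R) (u : R[i]) (s : R) (n x : nat) (k : R)
    : R[i] :=
  cpow q (n%:R * (s%:C - u + (k / 2 + 1 / 2)%:C)) *
  (\sum_(l < (minn n x).+1)
     (qpoch (q ^+ (2 * n)) (q ^- 2) l * qpoch (q ^+ (2 * x)) (q ^- 2) l *
      qpoch (q `^ (- 2 * x%:R - 2 * s - 2 * k)) (q ^- 2) l) /
     (qpoch (q `^ (- 2 * k)) (q ^- 2) l * qpoch (q ^- 2) (q ^- 2) l) *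
     q ^- (2 * l))%:C.

Definition weight (R : realType) (q k : R) (n : nat) : R :=
  q `^ (- n%:R * (k - 1)) *
  (qpoch (q `^ (2 * k)) (q ^+ 2) n / qpoch (q ^+ 2) (q ^+ 2) n).

Definition height (R : realType) (M : nat) (k : 'I_M -> R)
    (y : {ffun 'I_M -> nat}) (t : R) (i : nat) : R :=
  t + \sum_(l < M | (l < i)%N) (2 * (y l)%:R + k l).

Definition Phi (R : realType) (q : R) (M : nat) (k : 'I_M -> R)
    (v : R[i]) (t : R) (n y : {ffun 'I_M -> nat}) : R[i] :=
  \prod_(i < M) phi q v (height k y t i) (n i) (y i) (k i).

(* The sum over n in (Z_{>= 0})^M is the unconditional one: the limit of the
   finite partial sums along the directed set of finite sets of indices. *)
Definition Pr (R : realType) (q : R) (M : nat) (k : 'I_M -> R)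
    (s t : R) (v : R[i]) (x y : {ffun 'I_M -> nat}) : R[i] :=
  summability.sum (fun n : {ffun 'I_M -> nat} =>
    (Phi q k 1 s n x * Phi q k v t n y *
     (\prod_(i < M) weight q (k i) (n i))%:C : R[i]^o)).

(* Vectors in {0, +-1, +-2}^M are encoded as finite functions into 'I_5,
   a : 'I_5 standing for the integer a - 2. *)
Definition eps (M : nat) (e : {ffun 'I_M -> 'I_5}) (i : 'I_M) : int :=
  (e i)%:Z - 2.

Definition Eset (M j : nat) : {set {ffun 'I_M -> 'I_5}} :=
  [set e | [forall i : 'I_M, (i < M - j)%N ==> (eps e i == 0)] &&
           [forall l : 'I_M,
              \sum_(i < M | (i <= l)%N) eps e i \in [:: -1; 0; 1]]].

Definition admissible (M : nat) (y : {ffun 'I_M -> nat})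
    (e : {ffun 'I_M -> 'I_5}) : bool :=
  [forall i, 0 <= (y i)%:Z + eps e i].

(* Only meaningful when admissible y e holds. *)
Definition add_eps (M : nat) (y : {ffun 'I_M -> nat})
    (e : {ffun 'I_M -> 'I_5}) : {ffun 'I_M -> nat} :=
  [ffun i => absz ((y i)%:Z + eps e i)].

(* The coefficients c_{e,m}; in the names m1, m2 stand for -1, -2. For y = 0,
   the identical factors in the numerators and denominators of c_{1,0} and
   c_{0,2} are cancelled, as they may vanish. *)
Definition c_m1_0 (R : realType) (q : R) (y : nat) (t k : R) : R :=
  let Y := y%:R in
  if y == 0%N then 0 else
  q `^ (- 4 * Y - 2 * t - 3 * k + 2) *
    (1 - q `^ (- 2 * Y)) * (1 - q `^ (- 2 * Y - 2 * t)) /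
  ((1 - q `^ (- 4 * Y - 2 * t - 2 * k + 2)) *
   (1 - q `^ (- 4 * Y - 2 * t - 2 * k))).

Definition c_1_0 (R : realType) (q : R) (y : nat) (t k : R) : R :=
  let Y := y%:R in
  if y == 0%N then
    q `^ k * (1 - q `^ (- 2 * k)) / (1 - q `^ (- 2 * t - 2 * k - 2))
  else
  q `^ k * (1 - q `^ (- 2 * Y - 2 * k)) *
    (1 - q `^ (- 2 * Y - 2 * t - 2 * k)) /
  ((1 - q `^ (- 4 * Y - 2 * t - 2 * k)) *
   (1 - q `^ (- 4 * Y - 2 * t - 2 * k - 2))).

Definition c_0_0 (R : realType) (q : R) (y : nat) (t k : R) : R :=
  q `^ k - c_m1_0 q y t k - c_1_0 q y t k.

Definition c_m2_2 (R : realType) (q : R) (y : nat) (t k : R) : R :=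
  let Y := y%:R in
  q `^ k * (1 - q `^ (2 * Y)) * (1 - q `^ (2 * Y - 2)) /
  ((1 - q `^ (4 * Y + 2 * t + 2 * k)) *
   (1 - q `^ (4 * Y + 2 * t + 2 * k - 2))).

Definition c_m1_2 (R : realType) (q : R) (y : nat) (t k : R) : R :=
  let Y := y%:R in
  q `^ k * (1 + q ^+ 2) * (1 - q `^ (2 * Y)) *
    (1 - q `^ (- 2 * Y - 2 * k - 2 * t)) /
  ((1 - q `^ (4 * Y + 2 * t + 2 * k + 2)) *
   (1 - q `^ (- 4 * Y - 2 * k - 2 * t + 2))).

Definition c_0_2 (R : realType) (q : R) (y : nat) (t k : R) : R :=
  let Y := y%:R in
  if y == 0%N then q `^ k else
  q `^ k * (1 - q `^ (- 2 * Y - 2 * k - 2 * t)) *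
    (1 - q `^ (- 2 * Y - 2 * k - 2 * t - 2)) /
  ((1 - q `^ (- 4 * Y - 2 * k - 2 * t)) *
   (1 - q `^ (- 4 * Y - 2 * k - 2 * t - 2))).

Definition c_0_m2 (R : realType) (q : R) (y : nat) (t k : R) : R :=
  let Y := y%:R in
  q `^ k * (1 - q `^ (2 * Y + 2 * t)) * (1 - q `^ (2 * Y + 2 * t - 2)) /
  ((1 - q `^ (4 * Y + 2 * t + 2 * k)) *
   (1 - q `^ (4 * Y + 2 * t + 2 * k - 2))).

Definition c_1_m2 (R : realType) (q : R) (y : nat) (t k : R) : R :=
  let Y := y%:R in
  q `^ k * (1 + q ^+ 2) * (1 - q `^ (- 2 * Y - 2 * k)) *
    (1 - q `^ (2 * Y + 2 * t)) /
  ((1 - q `^ (- 4 * Y - 2 * k - 2 * t + 2)) *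
   (1 - q `^ (4 * Y + 2 * t + 2 * k + 2))).

Definition c_2_m2 (R : realType) (q : R) (y : nat) (t k : R) : R :=
  let Y := y%:R in
  q `^ k * (1 - q `^ (- 2 * Y - 2 * k)) * (1 - q `^ (- 2 * Y - 2 * k - 2)) /
  ((1 - q `^ (- 4 * Y - 2 * k - 2 * t)) *
   (1 - q `^ (- 4 * Y - 2 * k - 2 * t - 2))).

(* The default value is never reached for e in E_j: the partial sums of e lie
   in {-1, 0, 1}. *)
Definition coef (R : realType) (q : R) (e m : int) (y : nat) (t k : R) : R :=
  if (e, m) == (-1, 0) then c_m1_0 q y t k
  else if (e, m) == (0, 0) then c_0_0 q y t k
  else if (e, m) == (1, 0) then c_1_0 q y t k
  else if (e, m) == (-2, 2) then c_m2_2 q y t k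
  else if (e, m) == (-1, 2) then c_m1_2 q y t k
  else if (e, m) == (0, 2) then c_0_2 q y t k
  else if (e, m) == (0, -2) then c_0_m2 q y t k
  else if (e, m) == (1, -2) then c_1_m2 q y t k
  else if (e, m) == (2, -2) then c_2_m2 q y t k
  else 0.

Definition Ccoef (R : realType) (q : R) (M : nat) (k : 'I_M -> R) (j : nat)
    (e : {ffun 'I_M -> 'I_5}) (y : {ffun 'I_M -> nat}) (t : R) : R :=
  \prod_(i < M | (M - j <= i)%N)
    coef q (eps e i) (2 * \sum_(l < M | (l < i)%N) eps e l)
         (y i) (height k y t i) (k i).

Definition Dcoef (R : realType) (q : R) (M : nat) (k : 'I_M -> R) (v : R[i])
    (j : nat) (e : {ffun 'I_M -> 'I_5}) (y : {ffun 'I_M -> nat}) (t : R)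
    : R[i] :=
  let sigma := \sum_(i < M) eps e i in
  let C := (Ccoef q k j e y t)%:C in
  let h i := (height k y t i)%:C in
  if sigma == -1 then C * qbrace q (h M + v - 1)
  else if sigma == 1 then C * qbrace q (h M - v + 1)
  else if [forall i, eps e i == 0] then
    C * qbrace q (h M) * qbrace q v - qbrace q (h (M - j)%N) * qbrace q v
  else C * qbrace q (h M) * qbrace q v.

(* Main.v *)
From HB Require Import structures.
Require Import Defs.
From mathcomp Require Import all_boot all_order all_algebra.
From mathcomp Require Import finmap complex boolp classical_sets.
From mathcomp Require Import reals.
From mathcomp.analysis Require Import topology normedtype sequences exp trigo.
From mathcomp.analysis.showcase Require Import summability.
From mathcomp Require Import ring lra zify.

(* Fix n.  Up to a power of q, phi is a terminating 3phi2 in base p = q^-2 whose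
   data are N = q^(2n), X = q^(2x) and a = p^(x+s+k).  It has two kinds of
   recurrences.

   (1) In (y, t): the products of two contiguous relations (one lowering, one
   raising t) give, for m = 0, 2, -2,
     sum_e c_{e,m}(y,t;k) phi_{v,t+m}(n,y+e) = q^(2n+k) phi_{v,t}(n,y).
   The result is independent of m, so in several variables one can sum over
   eps_M, eps_(M-1), ... in turn:  sum_eps C_eps Phi(n,y+eps) = A(n) Phi(n,y)
   with A(n) the product of q^(2n_i+k_i) over i > M-j.

   (2) In n:  A {h_M} Phi_{u,s} = {h_(M-j)} Phi_{u,s} + q^(u-1) Z_+ Phi_{u,s}
   + q^(1-u) Z_- Phi_{u,s}, where Z_+ and Z_- raise and lower one of the last
   j components of n and do not depend on u and s.

   Since A q-commutes with Z_+ and Z_-, applying (2) before and after (1)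
   isolates  (Z_+ + Z_-) Phi_{v,t} = sum_eps D_eps Phi_{v,t}(n,y+eps), while
   (2) with u = 1 reads (Z_+ + Z_-) Phi_{1,s} = (A {h_M} - {h_(M-j)}) Phi_{1,s}.
   The theorem says that Z_+ + Z_- is symmetric with respect to the weight,
   which amounts to telescoping; all the series involved are dominated by
   geometric ones because Re v < 1 + s + t. *)

Set Implicit Arguments.
Unset Strict Implicit.
Unset Printing Implicit Defensive.

Import Order.TTheory GRing.Theory Num.Theory.
Import numFieldNormedType.Exports.

Local Open Scope ring_scope.
Local Open Scope complex_scope.

(** * q-Pochhammer symbols and truncated basic hypergeometric series *)

Section Pochhammer.
Variables (R : realType).
Implicit Types (a p : R).

Lemma qpoch0 a p : qpoch a p 0 = 1.
Proof. by rewrite /qpoch big_ord0. Qed.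

Lemma qpochS a p l : qpoch a p l.+1 = qpoch a p l * (1 - a * p ^+ l).
Proof. by rewrite /qpoch big_ord_recr. Qed.

Lemma qpochSl a p l : qpoch a p l.+1 = (1 - a) * qpoch (a * p) p l.
Proof.
rewrite /qpoch big_ord_recl /= expr0 mulr1; congr (_ * _).
by apply: eq_bigr => i _; rewrite exprS mulrA.
Qed.

Lemma qpoch_neq0 a p l : (forall i, a * p ^+ i != 1) -> qpoch a p l != 0.
Proof.
move=> h; rewrite /qpoch prodf_seq_neq0; apply/allP=> i _ /=.
by rewrite subr_eq0 eq_sym.
Qed.

Lemma qpoch_eq0 a p n l : a * p ^+ n = 1 -> (n < l)%N -> qpoch a p l = 0.
Proof.
move=> h lnl; rewrite /qpoch (bigD1 (Ordinal lnl)) //= h subrr mul0r //.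
Qed.

(** The first [L] terms of 3phi2(N, X, a; K, 0; p, p). The cut-off is independent of the parameters,
    so that series terminating at different places can be compared summand by summand. *)
Definition hyp32 (L : nat) (N X a K p : R) : R :=
  \sum_(l < L) (qpoch N p l * qpoch X p l * qpoch a p l) /
    (qpoch K p l * qpoch p p l) * p ^+ l.

End Pochhammer.

(** * Contiguous relations of the 3phi2 series *)

Section Contiguous.
Variables (R : realType) (p K : R).
Hypotheses (p0 : p != 0) (Kp : forall i, K * p ^+ i != 1)
  (pp : forall i, p * p ^+ i != 1).
Implicit Types N X a : R.

Let Kl l : 1 - K * p ^+ l != 0. Proof. by rewrite subr_eq0 eq_sym. Qed.
Let pl l : 1 - p * p ^+ l != 0. Proof. by rewrite subr_eq0 eq_sym. Qed.

(** True summand by summand: (1 - a) (ap; p)_l = (a; p)_l (1 - a p^l), likewise for X, and X (1 - a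
    p^l) - a (1 - X p^l) = X - a. *)
Lemma hyp32_raise L N X a : X != a ->
  hyp32 L N X a K p = (1 - a) * X / (X - a) * hyp32 L N X (a * p) K p
     - (1 - X) * a / (X - a) * hyp32 L N (X * p) a K p.
Proof.
rewrite -subr_eq0 => Xa; rewrite /hyp32 !mulr_sumr -sumrB; apply: eq_bigr => l _.
have {}Kn := qpoch_neq0 l Kp; have {}pn := qpoch_neq0 l pp.
have ha : (1 - a) * qpoch (a * p) p l = qpoch a p l * (1 - a * p ^+ l).
  by rewrite -qpochSl qpochS.
have hX : (1 - X) * qpoch (X * p) p l = qpoch X p l * (1 - X * p ^+ l).
  by rewrite -qpochSl qpochS.
transitivity (qpoch N p l * p ^+ l / (qpoch K p l * qpoch p p l) / (X - a) *
   (X * qpoch X p l * ((1 - a) * qpoch (a * p) p l)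
    - a * qpoch a p l * ((1 - X) * qpoch (X * p) p l))).
  by rewrite ha hX; field; rewrite Kn pn Xa.
by field; rewrite Kn pn Xa.
Qed.

(** Not a termwise identity: the difference of the summands telescopes, and the boundary term
    contains (N; p)_(n+1) = 0. *)
Lemma hyp32_lower n N X a : N * p ^+ n = 1 ->
  X != a -> X != 0 -> a != 0 ->
  N * hyp32 n.+1 N X a K p = (a - K) / (a - X) * hyp32 n.+1 N X (a / p) K p
     + (X - K) / (X - a) * hyp32 n.+1 N (X / p) a K p.
Proof.
rewrite -subr_eq0 => Nn Xa X0 a0; apply/eqP; rewrite -subr_eq0; apply/eqP.
have aX : a - X != 0 by rewrite -opprB oppr_eq0.
(* The certificate: summand l of the difference is [G l.+1 - G l]. *)
pose G l : R := if l is l'.+1 then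
  - (qpoch N p l * qpoch X p l' * qpoch a p l') /
    (qpoch K p l' * qpoch p p l') else 0.
have -> : 0 = G n.+1 - G 0%N by rewrite /G (qpoch_eq0 Nn) // !mul0r oppr0 mul0r addr0.
rewrite -(telescope_sumr G) // big_mkord /hyp32 !mulr_sumr -big_split -sumrB /=.
apply: eq_bigr => -[[|l] /= _] _.
  rewrite /G !qpochS !qpoch0 !expr0; field; by rewrite ?Xa ?aX ?X0 ?a0 ?p0 ?oner_neq0.

have {}Kn := qpoch_neq0 l Kp; have {}pn := qpoch_neq0 l pp.
rewrite (qpochSl (a / p)) (qpochSl (X / p)) !mulfVK // !qpochS.
rewrite !exprS; move: (Kl l) (pl l) (expf_neq0 l p0) => K1 p1 z0.
field; rewrite ?K1 ?p1 ?Kn ?pn ?Xa ?aX ?p0 //.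
Qed.

(** The three-term recurrence of the Al-Salam-Chihara polynomials in base p: [N / p] and [N * p] are
    the degrees n + 1 and n - 1. The bound on [L] makes the series of degree n + 1 complete. *)
Lemma hyp32_rec n L N X a : N * p ^+ n = 1 -> (n.+1 < L)%N ->
  N * (X + a) * hyp32 L N X a K p = (K + X * a) * hyp32 L N X a K p
     - (K - N) * hyp32 L (N / p) X a K p
     - X * a * (1 - N) * hyp32 L (N * p) X a K p.
Proof.
move=> Nn nL; apply/eqP; rewrite -subr_eq0; apply/eqP.
(* [G] is the certificate: the difference of the summands is [G l.+1 - G l]. *)
pose G l : R := if l is l'.+1 then
  - N * (qpoch N p l' * qpoch X p l * qpoch a p l) /
    (qpoch K p l' * qpoch p p l') else 0.
have -> : 0 = G L - G 0%N.
  case: L nL => // L nL.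
  by rewrite /G (qpoch_eq0 Nn) // !(mul0r,mulr0) subrr.
rewrite -(telescope_sumr G) // big_mkord /hyp32 !mulr_sumr -!sumrB /=.
apply: eq_bigr => -[[|l] /= _] _.
  move: (Kl 0) (pl 0); rewrite !mulr1 => K10 p10; rewrite /G !qpochS !qpoch0 !expr0; field.
  by rewrite ?K10 ?p10 ?oner_neq0.
have {}Kn := qpoch_neq0 l Kp; have {}pn := qpoch_neq0 l pp.
have hN : (1 - N) * qpoch (N * p) p l.+1 =
   qpoch N p l * (1 - N * p ^+ l) * (1 - N * p ^+ l.+1).
  by rewrite -qpochSl !qpochS.
rewrite (qpochSl (N / p)) !mulfVK // .
move: (Kl l) (pl l) (expf_neq0 l p0) => K1 p1 z0.
rewrite [X in _ - (_ - X)](_ : _ = X * a * ((1 - N) * qpoch (N * p) p l.+1) *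
    (qpoch X p l.+1 * qpoch a p l.+1 / (qpoch K p l.+1 * qpoch p p l.+1) *
    p ^+ l.+1)); last by ring.
rewrite hN /G !qpochS !exprS.
by field; rewrite ?K1 ?p1 ?Kn ?pn ?p0 //.
Qed.

End Contiguous.

(** * Complex powers of q *)

Section ComplexPower.
Variables (R : realType) (q : R).
Hypothesis q0 : 0 < q.
Implicit Types (z w : R[i]) (r : R).

Lemma cexpD z w : cexp (z + w) = cexp z * cexp w.
Proof.
case: z w => [a b] [c d]; rewrite /cexp /= expRD cosD sinD.
by apply/eqP; rewrite eq_complex /=; apply/andP; split; apply/eqP; ring.
Qed.

Lemma cpowD z w : cpow q (z + w) = cpow q z * cpow q w.
Proof. by rewrite /cpow mulrDl cexpD. Qed.

Lemma cpow_real r : cpow q r%:C = (q `^ r)%:C.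
Proof.
rewrite /cpow -rmorphM /cexp /= /powR gt_eqF //= cos0 sin0.
by rewrite -[1 +i* 0]/1%:C -rmorphM mulr1.
Qed.

Lemma cpow0 : cpow q 0 = 1.
Proof. by rewrite -[0]/(0%:C) cpow_real powRr0. Qed.

Lemma cpow_neq0 z : cpow q z != 0.
Proof.
apply/eqP => h; have := cpowD z (- z).
by rewrite subrr cpow0 h mul0r => /eqP; rewrite oner_eq0.
Qed.

Lemma cpowN z : cpow q (- z) = (cpow q z)^-1.
Proof.
apply: (mulfI (cpow_neq0 z)).
by rewrite -cpowD subrr cpow0 divff // cpow_neq0.
Qed.

Lemma cpow_mulrn n z : cpow q (n%:R * z) = cpow q z ^+ n.
Proof.
elim: n => [|n IH]; first by rewrite mul0r cpow0.
by rewrite -addn1 natrD mulrDl mul1r cpowD IH exprD expr1.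
Qed.

Lemma cpow_norm z : `|cpow q z| = (q `^ complex.Re z)%:C.
Proof.
case: z => a b; rewrite /cpow /cexp normrM ger0_norm ?lecR ?expR_ge0 //.
rewrite (_ : `|cos _ +i* sin _| = 1); last by rewrite normc_def /= cos2Dsin2 sqrtr1.
by rewrite mulr1 /= mulr0 subr0 /powR gt_eqF.
Qed.

Lemma qbrace_real r :
  qbrace q r%:C = ((q `^ r + q `^ (- r)) / (q + q^-1))%:C.
Proof. by rewrite /qbrace -rmorphN !cpow_real -rmorphD fmorph_div. Qed.

End ComplexPower.

(** * [phi] as a terminating series *)

Section Phi.
Variables (R : realType) (q : R).
Hypothesis hq : 0 < q < 1.
Implicit Types (u : R[i]) (s k : R) (n x : nat).

Let q0 : 0 < q. Proof. by case/andP: hq. Qed.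

Lemma qV2_mul_pow (n : nat) : q ^+ (2 * n) * q ^- 2 ^+ n = 1.
Proof. by rewrite exprM -exprMn divff ?expr1n // expf_neq0 // gt_eqF. Qed.

(** Beyond l = min(n, x), (N; p)_l or (X; p)_l is zero, so the cut-off can be chosen freely above
    min(n, x). *)
Lemma hyp32_min n x L (a K p N X : R) : N * p ^+ n = 1 -> X * p ^+ x = 1 ->
  (minn n x < L)%N -> hyp32 (minn n x).+1 N X a K p = hyp32 L N X a K p.
Proof.
move=> hN hX hL; rewrite /hyp32.
rewrite -!(big_mkord xpredT (fun l => (qpoch N p l * qpoch X p l * qpoch a p l) /
    (qpoch K p l * qpoch p p l) * p ^+ l)).
rewrite [RHS](big_cat_nat (leq0n _) hL) //= [X in _ = _ + X]big_nat.
rewrite [X in _ = _ + X]big1 ?addr0 //.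
move=> i /andP[hi _]; move: hi; rewrite gtn_min => /orP[] hi.
  by rewrite (qpoch_eq0 hN hi) !mul0r.
by rewrite (qpoch_eq0 hX hi) mulr0 !mul0r.
Qed.

Lemma phiE u s n x k L : (minn n x < L)%N ->
  phi q u s n x k = cpow q (s%:C - u + (k / 2 + 1 / 2)%:C) ^+ n *
    (hyp32 L (q ^+ (2 * n)) (q ^+ (2 * x)) (q `^ (- 2 * x%:R - 2 * s - 2 * k))
      (q `^ (- 2 * k)) (q ^- 2))%:C.
Proof.
move=> hL; rewrite -(hyp32_min _ _ (qV2_mul_pow n) (qV2_mul_pow x) hL).
rewrite /phi cpow_mulrn //; congr (_ * _%:C).
by apply: eq_bigr => l _; rewrite exprVn -exprM.
Qed.

Lemma powR_neq1 (r : R) : r != 0 -> q `^ r != 1.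
Proof.
move=> r0; apply/eqP => h; have := ln_powR q r.
rewrite h ln1 => /esym/eqP; rewrite mulf_eq0 (negbTE r0) /=.
by rewrite lt_eqF // ln_lt0.
Qed.

Lemma qV2_powR (i : nat) : q ^- 2 ^+ i = q `^ (- 2 * i%:R).
Proof. by rewrite exprVn -exprM -powR_mulrn ?ltW // -powRN natrM mulNr. Qed.

End Phi.

(** * Products of two contiguous relations; [kap] will be q^k *)

Section TwoStepContiguous.
Variables (R : realType) (p kap : R).
Let K := kap ^- 2.
Hypotheses (p0 : p != 0) (k0 : kap != 0) (Kp : forall i, K * p ^+ i != 1)
  (pp : forall i, p * p ^+ i != 1).
Variables (n : nat) (N X a : R).
Hypotheses (Nn : N * p ^+ n = 1) (X0 : X != 0) (a0 : a != 0).
Let H X a := hyp32 n.+1 N X a K p.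

(** The case m = 2: raise once, then raise both resulting series. The two paths to
    [H (X * p) (a * p)] combine into the factor 1 + 1/p. *)
Lemma hyp32_up2 : X != a -> X != a * p -> X * p != a ->
  kap * (1 - X) * (1 - X * p) / ((1 - X / a) * (1 - X / a * p))
      * H (X * p * p) a
  + kap * (1 + p^-1) * (1 - X) * (1 - a) /
      ((1 - X / a * p^-1) * (1 - a / X * p^-1)) * H (X * p) (a * p)
  + kap * (1 - a) * (1 - a * p) / ((1 - a / X) * (1 - a / X * p))
      * H X (a * p * p)
  = kap * H X a.
Proof.
move=> h1 h2 h3; rewrite /H (hyp32_raise Kp pp _ _ h1).
rewrite (hyp32_raise Kp pp _ _ h2) (hyp32_raise Kp pp _ _ h3).
move: (hyp32 _ _ (X * p * p) _ _ _) (hyp32 _ _ (X * p) _ _ _)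
  (hyp32 _ _ X _ _ _) => h h' h''.
by field; rewrite ?mulNr ?a0 !subr_eq0 !(eq_sym a) ?(eq_sym (a * p)) h1 h2 h3 p0 X0 ?k0.
Qed.
(** The case m = 0: lower once, then raise both resulting series. Both return to [H X a]; the
    differences reflect c_{0,0} = q^k - c_{-1,0} - c_{1,0}. *)
Lemma hyp32_same : X != a -> X * p != a -> X != a * p ->
  kap ^-1 * (a / X) * p^-1 * (1 - X^-1) * (1 - a * kap ^+ 2) /
      ((1 - a / X * p^-1) * (1 - a / X)) * (H (X * p) (a / p) - H X a)
  + kap * H X a
  + kap * (1 - K / X) * (1 - a) /
      ((1 - a / X) * (1 - a / X * p)) * (H (X / p) (a * p) - H X a)
  = kap * N * H X a.
Proof.
move=> h1 h2 h3.
have h4 : X != a / p by apply: contra h2 => /eqP ->; rewrite mulfVK.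
have h5 : X / p != a by apply: contra h3 => /eqP <-; rewrite mulfVK.
rewrite -[in RHS]mulrA /H (hyp32_lower p0 Kp pp Nn h1 X0 a0).
rewrite (hyp32_raise Kp pp _ _ h4) (hyp32_raise Kp pp _ _ h5).
rewrite !mulfVK //.
move: (hyp32 _ _ (X * p) _ _ _) (hyp32 _ _ (X / p) _ _ _)
  (hyp32 _ _ X _ _ _) => h h' h''.
rewrite /K.
by field; rewrite ?mulNr ?a0 !subr_eq0 !(eq_sym a) ?(eq_sym (a * p)) h1 h2 h3 p0 X0 ?k0.
Qed.

(** The case m = -2: lower twice, each time at the price of a factor [N]. *)
Lemma hyp32_down2 : X != a -> X * p != a -> X != a * p ->
  kap * (1 - K / a) * (1 - K / a * p) / ((1 - X / a) * (1 - X / a * p))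
      * H X (a / p / p)
  + kap * (1 + p^-1) * (1 - K / X) * (1 - K / a) /
      ((1 - a / X * p^-1) * (1 - X / a * p^-1)) * H (X / p) (a / p)
  + kap * (1 - K / X) * (1 - K / X * p) / ((1 - a / X) * (1 - a / X * p))
      * H (X / p / p) a
  = kap * N ^+ 2 * H X a.
Proof.
move=> h1 h2 h3.
have h4 : X != a / p by apply: contra h2 => /eqP ->; rewrite mulfVK.
have h5 : X / p != a by apply: contra h3 => /eqP <-; rewrite mulfVK.
have ap0 : a / p != 0 by rewrite mulf_neq0 ?invr_eq0.
have Xp0 : X / p != 0 by rewrite mulf_neq0 ?invr_eq0.
rewrite expr2 -[in RHS]mulrA -[N * N * _]mulrA /H (hyp32_lower p0 Kp pp Nn h1 X0 a0).
rewrite [N * (_ + _)]mulrDr !(mulrCA N).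
rewrite (hyp32_lower p0 Kp pp Nn h4 X0 ap0).
rewrite (hyp32_lower p0 Kp pp Nn h5 Xp0 a0).
move: (hyp32 _ _ X _ _ _) (hyp32 _ _ (X / p) _ _ _)
  (hyp32 _ _ (X / p / p) _ _ _) => h h' h''.
rewrite /K.
by field; rewrite ?mulNr ?a0 !subr_eq0 !(eq_sym a) ?(eq_sym (a * p)) h1 h2 h3 p0 X0 ?k0.
Qed.
End TwoStepContiguous.

(** * Univariate recurrences in (y, t) and in n *)

Section Recurrences.
Variables (R : realType) (q : R).
Hypothesis hq : 0 < q < 1.
Variable k : R.
Hypothesis hk : 0 < k.
Implicit Types (t : R) (n y : nat).

Let q0 : 0 < q. Proof. by case/andP: hq. Qed.
Let qn0 : q != 0. Proof. by rewrite gt_eqF. Qed.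
Let qD r s : q `^ (r + s) = q `^ r * q `^ s.
Proof. by rewrite powRD // qn0 implybT. Qed.
Let qX n : q ^+ n = q `^ n%:R. Proof. by rewrite powR_mulrn // ltW. Qed.
Let qXV n : q ^- n = q `^ (- n%:R). Proof. by rewrite powRN qX. Qed.

Ltac qpow := rewrite ?invrK ?qXV ?qX -?powRN -?qD;
  congr (q `^ _); rewrite ?mulnS ?(natrD, natrM); ring.

(** The factor of [phi] free of u: up to normalisation an Al-Salam-Chihara polynomial of degree n in
    base q^-2. The cut-off [n.+1] does not change when y is shifted. *)
Definition phi_poly n y t : R := hyp32 n.+1 (q ^+ (2 * n)) (q ^+ (2 * y))
  (q `^ (- 2 * y%:R - 2 * t - 2 * k)) (q `^ k ^- 2) (q ^- 2).

Lemma phi_polyE u t n y :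
  phi q u t n y k = cpow q (t%:C - u + (k / 2 + 1 / 2)%:C) ^+ n * (phi_poly n y t)%:C.
Proof.
rewrite (phiE hq _ _ _ (L := n.+1)) ?ltnS ?geq_minl // /phi_poly.
by rewrite (_ : q `^ k ^- 2 = q `^ (- 2 * k)) //; rewrite expr2 -qD; qpow.
Qed.

Let pn0 : q ^- 2 != 0. Proof. by rewrite invr_eq0 expf_neq0. Qed.
Let kn0 : q `^ k != 0. Proof. by rewrite gt_eqF ?powR_gt0. Qed.
Let XX r : q `^ r ^+ 2 = q `^ (r + r). Proof. by rewrite expr2 -qD. Qed.
Let Kp i : q `^ k ^- 2 * q ^- 2 ^+ i != 1.
Proof.
rewrite XX qV2_powR // -powRN -qD powR_neq1 //.
by rewrite lt_eqF //; have ? := ler0n R i; have ? := hk; lra.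
Qed.
Let pp i : q ^- 2 * q ^- 2 ^+ i != 1.
Proof.
rewrite -exprS qV2_powR // powR_neq1 //.
by rewrite lt_eqF //; have ? := ltr0Sn R i; have ? := hk; lra.
Qed.

Let XS y : q ^+ (2 * y.+1) * q ^- 2 = q ^+ (2 * y).
Proof. by rewrite mulnS exprD mulrC mulKf // expf_neq0. Qed.
Let neq (r s : R) : r - s != 0 -> q `^ r != q `^ s.
Proof.
move=> rs; apply: contra (powR_neq1 hq rs) => /eqP h.
by rewrite qD h -qD subrr powRr0.
Qed.

(** At y = 1 the shift by -2 leaves the nonnegative integers; the zero coefficient makes the default
    value of the predecessor harmless. *)
Lemma c_m2_2_1 t : c_m2_2 q 1 t k = 0.
Proof. by rewrite /c_m2_2 mulr1 subrr powRr0 subrr !(mul0r, mulr0). Qed.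

Lemma phi_poly0 n t : phi_poly n 0 t = 1.
Proof.
rewrite /phi_poly -(hyp32_min _ _ (qV2_mul_pow hq n) (qV2_mul_pow hq 0)) ?minn0 //.
by rewrite /hyp32 big_ord1 !qpoch0 !mulr1 divr1.
Qed.

(** [hyp32_up2] in the original variables, for [y.+1] because c_{0,2} has its cancelled form at 0.
    The bound on t yields the required inequalities between X and a. *)
Lemma phi_poly_up2 n y t : -1 < t ->
  c_m2_2 q y.+1 t k * phi_poly n y.-1 (t + 2) + c_m1_2 q y.+1 t k * phi_poly n y (t + 2)
  + c_0_2 q y.+1 t k * phi_poly n y.+1 (t + 2) = q `^ k * phi_poly n y.+1 t.
Proof.
move=> ht; set X := q ^+ (2 * y.+1); set a := q `^ (- 2 * y.+1%:R - 2 * t - 2 * k).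
have y0 := ler0n R y; have hk' := hk.
have X0 : X != 0 by rewrite expf_neq0.
have a0 : a != 0 by rewrite gt_eqF ?powR_gt0.
have h1 : X != a.
  rewrite /X /a qX; apply: neq; rewrite natrM -(natr1 y) gt_eqF //; lra.
have h2 : X != a * q ^- 2.
  rewrite /X /a qX qXV -qD; apply: neq; rewrite natrM -(natr1 y) gt_eqF //; lra.
have h3 : X * q ^- 2 != a.
  rewrite /X /a qX qXV -qD; apply: neq; rewrite natrM -(natr1 y) gt_eqF //; lra.
rewrite -(hyp32_up2 pn0 Kp pp n (q ^+ (2 * n)) X0 a0 h1 h2 h3).
congr (_ + _ + _).
- case: y @X @a X0 a0 h1 h2 h3 y0 => [|y] X a X0 a0 h1 h2 h3 _.
    rewrite c_m2_2_1 /X muln1 mulfV ?expf_neq0 // subrr.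
    by rewrite !(mul0r, mulr0).
  congr (_ * _).
    rewrite /c_m2_2; congr (_ * (1 - _) * (1 - _) / ((1 - _) * (1 - _))).
    + rewrite /X; qpow.
    + rewrite /X; qpow.
    + rewrite /X /a; qpow.
    + rewrite /X /a; qpow.
  rewrite /phi_poly /X !XS; congr (hyp32 _ _ _ _ _ _).
  rewrite /a; qpow.
- rewrite /c_m1_2 /phi_poly XS; congr (_ * hyp32 _ _ _ _ _ _); last by rewrite /a; qpow.
  rewrite /c_m1_2 invrK; congr (_ * (1 - _) * (1 - _) / ((1 - _) * (1 - _))).
  + by rewrite /X; qpow.
  + by rewrite /a; qpow.
  + by rewrite /X /a; qpow.
  + by rewrite /X /a; qpow.
- rewrite /c_0_2 /phi_poly /=; congr (_ * hyp32 _ _ _ _ _ _); last by rewrite /a; qpow.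
  congr (_ * (1 - _) * (1 - _) / ((1 - _) * (1 - _))).
  + by rewrite /a; qpow.
  + by rewrite /X /a; qpow.
  + by rewrite /X /a; qpow.
  + by rewrite /X /a; qpow.
Qed.

Let XV y : q ^+ (2 * y) / q ^- 2 = q ^+ (2 * y.+1).
Proof. by rewrite invrK -exprD mulnS addnC. Qed.

Lemma phi_poly_down2 n y t : 1 < t ->
  c_0_m2 q y t k * phi_poly n y (t - 2) + c_1_m2 q y t k * phi_poly n y.+1 (t - 2)
  + c_2_m2 q y t k * phi_poly n y.+2 (t - 2) =
  q `^ k * q ^+ (2 * n) ^+ 2 * phi_poly n y t.
Proof.
move=> ht; set X := q ^+ (2 * y); set a := q `^ (- 2 * y%:R - 2 * t - 2 * k).
have y0 := ler0n R y; have hk' := hk.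
have X0 : X != 0 by rewrite expf_neq0.
have a0 : a != 0 by rewrite gt_eqF ?powR_gt0.
have h1 : X != a.
  rewrite /X /a qX; apply: neq; rewrite natrM gt_eqF //; lra.
have h2 : X != a * q ^- 2.
  rewrite /X /a qX qXV -qD; apply: neq; rewrite natrM gt_eqF //; lra.
have h3 : X * q ^- 2 != a.
  rewrite /X /a qX qXV -qD; apply: neq; rewrite natrM gt_eqF //; lra.
rewrite -(hyp32_down2 pn0 kn0 Kp pp (qV2_mul_pow hq n) X0 a0 h1 h3 h2).
congr (_ + _ + _).
- rewrite /c_0_m2 /phi_poly; congr (_ * hyp32 _ _ _ _ _ _).
    congr (_ * (1 - _) * (1 - _) / ((1 - _) * (1 - _))).
    + by rewrite /a expr2 -qD; qpow.
    + by rewrite /a expr2 -qD; qpow.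
    + by rewrite /X /a; qpow.
    + by rewrite /X /a; qpow.
  by rewrite /a invrK; qpow.
- rewrite /c_1_m2 /phi_poly /X -?XV; congr (_ * hyp32 _ _ _ _ _ _).
    rewrite invrK; congr (_ * (1 - _) * (1 - _) / ((1 - _) * (1 - _))).
    + by rewrite /X expr2 -qD; qpow.
    + by rewrite /a expr2 -qD; qpow.
    + by rewrite /X /a; qpow.
    + by rewrite /X /a; qpow.
  by rewrite /a invrK -(natr1 y); qpow.
- rewrite /c_2_m2 /phi_poly /X -?XV; congr (_ * hyp32 _ _ _ _ _ _).
    congr (_ * (1 - _) * (1 - _) / ((1 - _) * (1 - _))).
    + by rewrite /X expr2 -qD; qpow.
    + by rewrite /X expr2 -qD; qpow.
    + by rewrite /X /a; qpow.
    + by rewrite /X /a; qpow.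
  by rewrite /a -(natr1 y.+1) -(natr1 y); qpow.
Qed.

Lemma phi_poly_same n y t : -1 < t ->
  c_m1_0 q y t k * phi_poly n y.-1 t + c_0_0 q y t k * phi_poly n y t
  + c_1_0 q y t k * phi_poly n y.+1 t = q `^ k * q ^+ (2 * n) * phi_poly n y t.
Proof.
case: y => [|y] ht; last first.
  set X := q ^+ (2 * y.+1); set a := q `^ (- 2 * y.+1%:R - 2 * t - 2 * k).
  have y0 := ler0n R y; have hk' := hk.
  have X0 : X != 0 by rewrite expf_neq0.
  have a0 : a != 0 by rewrite gt_eqF ?powR_gt0.
  have h1 : X != a.
    rewrite /X /a qX; apply: neq; rewrite natrM -(natr1 y) gt_eqF //; lra.
  have h2 : X != a * q ^- 2.
    rewrite /X /a qX qXV -qD; apply: neq; rewrite natrM -(natr1 y) gt_eqF //; lra.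
  have h3 : X * q ^- 2 != a.
    rewrite /X /a qX qXV -qD; apply: neq; rewrite natrM -(natr1 y) gt_eqF //; lra.
  rewrite -(hyp32_same pn0 kn0 Kp pp (qV2_mul_pow hq n) X0 a0 h1 h3 h2).
  rewrite /c_0_0 [LHS](_ : _ = c_m1_0 q y.+1 t k * (phi_poly n y t - phi_poly n y.+1 t) +
     q `^ k * phi_poly n y.+1 t +
     c_1_0 q y.+1 t k * (phi_poly n y.+2 t - phi_poly n y.+1 t)); last by rewrite /=; ring.
  congr (_ + _ + _).
  - rewrite /c_m1_0 /phi_poly /X XS /=; congr (_ * (hyp32 _ _ _ _ _ _ - _)).
      congr (_ * (1 - _) * (1 - _) / ((1 - _) * (1 - _))).
      + by rewrite /X /a; qpow.
      + by rewrite /X; qpow.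
      + by rewrite /a expr2 -qD; qpow.
      + by rewrite /X /a; qpow.
      + by rewrite /X /a; qpow.
    by rewrite /a invrK -(natr1 y); qpow.
  - rewrite /c_1_0 /phi_poly /X -(XV y.+1) /=; congr (_ * (hyp32 _ _ _ _ _ _ - _)).
      congr (_ * (1 - _) * (1 - _) / ((1 - _) * (1 - _))).
      + by rewrite /X expr2 -qD; qpow.
      + by rewrite /X /a; qpow.
      + by rewrite /X /a; qpow.
    by rewrite /a -(natr1 y.+1) -(natr1 y); qpow.
(* At y = 0 the general relation would divide by zero when t = -k. With c_{1,0} in its cancelled
   form, the identity is checked directly on the two terms of [phi_poly n 1 t]. *)
have E1 : phi_poly n 1 t = 1 + (1 - q ^+ (2 * n)) * (1 - q ^+ 2)
   * (1 - q `^ (- 2 - 2 * t - 2 * k)) / ((1 - q `^ k ^- 2) * (1 - q ^- 2)) * q ^- 2.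
  rewrite /phi_poly -(hyp32_min _ _ (qV2_mul_pow hq n) (qV2_mul_pow hq 1)) ?ltnS ?geq_minl //.
  rewrite (hyp32_min _ _ (qV2_mul_pow hq n) (qV2_mul_pow hq 1) (L := 2)) ?ltnS ?geq_minr //.
  rewrite /hyp32 big_ord_recl big_ord1 /= !qpoch0 !mulr1 divr1; congr (_ + _).
  by rewrite /qpoch !big_ord1 !expr0 !mulr1 expr1.
rewrite phi_poly0 E1 /c_0_0 /c_m1_0 /c_1_0 /=.
have hk' := hk.
have d1 : 1 - q `^ (- 2 - 2 * t - 2 * k) != 0.
  by rewrite subr_eq0 eq_sym powR_neq1 // lt_eqF //; lra.
have d2 := Kp 0; have d3 := pp 0; rewrite !expr0 !mulr1 in d2 d3.
rewrite (_ : - 2 * t - 2 * k - 2 = - 2 - 2 * t - 2 * k); last by ring.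
rewrite (_ : q `^ (- 2 * k) = q `^ k ^- 2); last by rewrite expr2 -qD; qpow.
rewrite eq_sym -subr_eq0 in d2; rewrite eq_sym -subr_eq0 in d3.
move: d1 d2 d3 kn0 qn0; set z := q `^ (- 2 - _ - _); move: (q `^ k) (q ^+ (2 * n)).
move=> kk N d1 d2 d3 k0 p0.
have d2' : kk ^+ 2 - 1 != 0.
  apply: contra d2; move=> /eqP/subr0_eq ->; by rewrite invr1 subrr.
have d3' : q ^+ 2 - 1 != 0.
  apply: contra d3; move=> /eqP/subr0_eq ->; by rewrite invr1 subrr.
by field; rewrite p0 k0 d3' d2' d1.
Qed.

(** The coefficients of degrees n + 1 and n - 1 after q^(u-1) and q^(1-u) are split off.
    [lower_coef] vanishes at n = 0, where [n.-1] is a default. *)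
Definition raise_coef n : R :=
  - q `^ (1 / 2 - k / 2) * (1 - q `^ k ^+ 2 * q ^+ (2 * n)) / (q + q^-1).
Definition lower_coef n : R :=
  - q `^ (k / 2 - 1 / 2) * (1 - q ^+ (2 * n)) / (q + q^-1).

(** [hyp32_rec] rescaled: with B = q^(s - u + (k+1)/2), [phi] is B^n times a series free of u, and
    neither q^(u-1) B nor q^(1-u) / B depends on u. *)
Lemma phi_rec u s n x :
  (q ^+ (2 * n) * q `^ k)%:C * qbrace q (s + (2 * x%:R + k))%:C * phi q u s n x k
  = qbrace q s%:C * phi q u s n x k
    + cpow q (u - 1) * (raise_coef n)%:C * phi q u s n.+1 x k
    + cpow q (1 - u) * (lower_coef n)%:C * phi q u s n.-1 x k.
Proof.
set X := q ^+ (2 * x); set a := q `^ (- 2 * x%:R - 2 * s - 2 * k).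
set K := q `^ (- 2 * k).
pose h N := hyp32 n.+2 N X a K (q ^- 2).
set B := cpow q (s%:C - u + (k / 2 + 1 / 2)%:C).
set N := q ^+ (2 * n).
have KE : K = q `^ k ^- 2 by rewrite /K expr2 -qD; qpow.
have Kp' i : K * q ^- 2 ^+ i != 1 by rewrite KE.
have := hyp32_rec pn0 Kp' pp X a (qV2_mul_pow hq n) (ltnSn n.+1).
rewrite -/(h _) -/(h (_ / _)) -/(h (_ * _)) -/N => hrec.
have e0 : phi q u s n x k = B ^+ n * (h N)%:C.
  by rewrite (phiE hq _ _ _ (L := n.+2)) // ltnS leqW // geq_minl.
have e1 : phi q u s n.+1 x k = B ^+ n * B * (h (N / q ^- 2))%:C.
  by rewrite -exprSr XV (phiE hq _ _ _ (L := n.+2)) // ltnS geq_minl.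
(* The factor 1 - N is kept because the equality without it would fail to make sense of degree -1;
   at n = 0 both sides vanish. *)
have e2 : (1 - N)%:C * phi q u s n.-1 x k =
   (1 - N)%:C * (B ^+ n * B^-1 * (h (N * q ^- 2))%:C).
  rewrite /N /h; case: (n) => [|m]; first by rewrite muln0 expr0 subrr !mul0r.
  rewrite XS exprSr mulfK ?cpow_neq0 //; congr (_ * _).
  by rewrite (phiE hq _ _ _ (L := m.+3)) // ltnS leqW // leqW // geq_minl.
have f1 : cpow q (u - 1) * B = (q `^ (s + k / 2 - 1 / 2))%:C.
  rewrite -cpowD // -cpow_real //; congr (cpow q _).
  by rewrite !(rmorphD, rmorphB, rmorph1) /=; field.
have f2 : cpow q (1 - u) / B = (q `^ (1 / 2 - s - k / 2))%:C.
  rewrite -cpowN // -cpowD // -cpow_real //; congr (cpow q _).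
  by rewrite !(rmorphD, rmorphB, rmorph1) /=; field.
rewrite [X in _ = _ + X](_ : _ = cpow q (1 - u) * (- q `^ (k / 2 - 1 / 2) / (q + q^-1))%:C
   * ((1 - N)%:C * phi q u s n.-1 x k)); last first.
  rewrite (_ : lower_coef n = - q `^ (k / 2 - 1 / 2) / (q + q^-1) * (1 - N)).
    by rewrite rmorphM; ring.
  by rewrite /lower_coef -/N; ring.
rewrite e2 e1 e0 !qbrace_real //.
rewrite [X in _ = _ + X + _](_ : _ = B ^+ n * (cpow q (u - 1) * B *
   (raise_coef n * h (N / q ^- 2))%:C)); last by rewrite (rmorphM _ (raise_coef n)); ring.
rewrite [X in _ = _ + X](_ : _ = B ^+ n * (cpow q (1 - u) / B *
   (- q `^ (k / 2 - 1 / 2) / (q + q^-1) * (1 - N) * h (N * q ^- 2))%:C)); last first.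
  by rewrite !rmorphM; ring.
rewrite f1 f2 mulrCA [X in _ = X + _ + _]mulrCA -!(rmorphM (real_complex R)).
rewrite -!mulrDr -!(rmorphD (real_complex R)) /=.
congr (_ * _%:C).
rewrite /raise_coef -/N.
have qq : q + q^-1 != 0 by rewrite gt_eqF // addr_gt0 ?invr_gt0.
have g1 : q `^ (s + k / 2 - 1 / 2) * q `^ (1 / 2 - k / 2) = q `^ s.
  by rewrite -qD; congr (q `^ _); ring.
have g2 : q `^ (1 / 2 - s - k / 2) * q `^ (k / 2 - 1 / 2) = q `^ (- s).
  by rewrite -qD; congr (q `^ _); ring.
have g3 : q `^ (s + (2 * x%:R + k)) = q `^ s * q `^ k * X by rewrite /X; qpow.
have g4 : q `^ (- (s + (2 * x%:R + k))) = q `^ s * q `^ k * a by rewrite /a; qpow.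
have g5 : X * a = K * q `^ (- s) ^+ 2.
  by rewrite /X /a /K expr2; qpow.
have g6 : q `^ s * q `^ (- s) = 1 by rewrite -qD subrr powRr0.
have S0 : q `^ s != 0 by rewrite gt_eqF ?powR_gt0.
have X0 : X != 0 by rewrite expf_neq0.
have g7 : a = K * q `^ (- s) ^+ 2 / X by rewrite -g5 mulrC mulKf.
have g8 : q `^ (- s) = (q `^ s)^-1 by rewrite powRN.
rewrite g3 g4.
move: hrec; move: (h N) (h (N / _)) (h (N * _)) => h0 h1 h2 hrec.
transitivity (q `^ k ^+ 2 * q `^ s / (q + q^-1) * (N * (X + a) * h0)); first by ring.
rewrite hrec.
transitivity ((q `^ s + q `^ (- s)) / (q + q^-1) * h0
  - (q `^ (s + k / 2 - 1 / 2) * q `^ (1 / 2 - k / 2)) * (1 - q `^ k ^+ 2 * N) / (q + q^-1) * h1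
  - (q `^ (1 / 2 - s - k / 2) * q `^ (k / 2 - 1 / 2)) * (1 - N) / (q + q^-1) * h2);
  last by ring.
rewrite g1 g2 g8 g7 KE g8; move: kn0 S0 X0.
move: (q + q^-1)^-1 => iQ h00 S00 X00.
by field; rewrite ?h00 ?S00 ?X00.
Qed.

End Recurrences.

(** * Iterated sums over vectors with constraints on prefixes *)

Definition upd (M : nat) (A : Type) (e : {ffun 'I_M -> A}) (i : 'I_M) (a : A)
  : {ffun 'I_M -> A} := [ffun l => if l == i then a else e l].

Section Transfer.
Variables (M : nat) (A : finType) (a0 : A) (F : comNzRingType).
Variables (ok : 'I_M -> {ffun 'I_M -> A} -> bool)
  (f : 'I_M -> {ffun 'I_M -> A} -> F) (T : 'I_M -> F).
Hypothesis ok_local : forall (i : 'I_M) (e e' : {ffun 'I_M -> A}),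
  (forall l : 'I_M, (l <= i)%N -> e l = e' l) -> ok i e = ok i e'.
Hypothesis f_local : forall (i : 'I_M) (e e' : {ffun 'I_M -> A}),
  (forall l : 'I_M, (l <= i)%N -> e l = e' l) -> f i e = f i e'.
Hypothesis fiber : forall (i : 'I_M) (e : {ffun 'I_M -> A}),
  (forall l : 'I_M, (l < i)%N -> ok l e) ->
  \sum_(a | ok i (upd e i a)) f i (upd e i a) = T i.

(** Sum over the last component first: by [fiber] the result does not depend on the earlier
    components, so it factors out and the argument repeats. *)
Lemma sum_prod_fiber :
  \sum_(e : {ffun 'I_M -> A} | [forall i, ok i e]) \prod_i f i e = \prod_i T i.
Proof.
(* Components below r are free, the others frozen at [a0], so every stage of the induction sums over
   the same finite type. *)
pose P r e := [forall i : 'I_M, if (i < r)%N then ok i e else e i == a0].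
have H r : (r <= M)%N -> \sum_(e | P r e) \prod_(i < M | (i < r)%N) f i e
    = \prod_(i < M | (i < r)%N) T i.
  elim: r => [|r IH] rM.
    rewrite [RHS]big_pred0 // (big_pred1 [ffun=> a0]) ?big_pred0 // => e.
    apply/forallP/eqP => [h|-> i]; last by rewrite ffunE eqxx.
    by apply/ffunP => i; rewrite ffunE; apply/eqP/(h i).
  pose i0 := Ordinal rM.
  have prodS (g : 'I_M -> F) : \prod_(i < M | (i < r.+1)%N) g i =
      (\prod_(i < M | (i < r)%N) g i) * g i0.
    rewrite (bigD1 i0) //= mulrC; congr (_ * _); apply: eq_bigl => i.
    by rewrite -val_eqE /= ltnS ltn_neqAle andbC.
  rewrite prodS -IH ?(ltnW rM) // mulr_suml.
  (* Vectors are grouped by what is left after resetting component r; each class is then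
     parametrised by that component. *)
  rewrite (partition_big (fun e => upd e i0 a0) (P r)) /=; last first.
    move=> e /forallP h; apply/forallP => i; have := h i.
    rewrite ffunE ltnS -val_eqE /=; case: (ltngtP i r) => //= ir.
    rewrite (@ok_local _ e (upd e i0 a0)) // => l li.
    by rewrite ffunE -val_eqE /= ltn_eqF // (leq_ltn_trans li).
  apply: eq_bigr => e0 /forallP h0.
  have lt_upd a (l : 'I_M) : (l < r)%N -> upd e0 i0 a l = e0 l.
    by move=> lr; rewrite ffunE -val_eqE /= ltn_eqF.
  have e0a : e0 i0 = a0 by have := h0 i0; rewrite ltnn => /eqP.
  rewrite (reindex_onto (fun a => upd e0 i0 a) (fun e => e i0)); last first.
    move=> e /andP[_ /eqP <-]; apply/ffunP => l; rewrite !ffunE.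
    by case: eqVneq => // ->.
  transitivity (\sum_(a | ok i0 (upd e0 i0 a))
     (\prod_(i < M | (i < r)%N) f i e0) * f i0 (upd e0 i0 a)); last first.
    rewrite -mulr_sumr fiber // => l lr.
    by have := h0 l; rewrite lr.
  apply: eq_big => [a|a _].
    rewrite ffunE eqxx eqxx andbT.
    have -> : upd (upd e0 i0 a) i0 a0 = e0.
      by apply/ffunP => l; rewrite !ffunE; case: eqVneq => // ->.
    rewrite eqxx andbT; apply/forallP/idP => [/(_ i0)|h i]; first by rewrite ltnSn.
    rewrite ltnS; case: (ltngtP i r) => ir.
    - have := h0 i; rewrite ir (@ok_local _ e0 (upd e0 i0 a)) // => l li.
      by rewrite lt_upd // (leq_ltn_trans li).
    - by rewrite ffunE -val_eqE /= gtn_eqF //; have := h0 i; rewrite ltnNge ltnW.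
    - by have -> : i = i0 by exact: val_inj.
  rewrite prodS; congr (_ * _); apply: eq_bigr => i ir.
  by apply: f_local => l li; rewrite lt_upd // (leq_ltn_trans li).
transitivity (\sum_(e | P M e) \prod_(i < M | (i < M)%N) f i e).
  apply: eq_big => [e|e _]; first by apply: eq_forallb => i; rewrite ltn_ord.
  by apply: eq_bigl => i; rewrite ltn_ord.
by rewrite H //; apply: eq_bigl => i; rewrite ltn_ord.
Qed.

End Transfer.

(** * The univariate sum over shifts *)

Section CoefSum.
Variables (R : realType) (q : R).
Hypothesis hq : 0 < q < 1.
Variable k : R.
Hypothesis hk : 0 < k.
Implicit Types (t : R) (n y : nat).

Let q0 : 0 < q. Proof. by case/andP: hq. Qed.

(** [sg] is the sum of the preceding shifts. With N = q^(2n), the polynomial identities give q^k,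
    q^k N, q^k N^2 for sg = 1, 0, -1, and t + 2 sg contributes N^sg through the power of q in [phi];
    the product is always q^k N. *)
Lemma coef_phi_sum u (sg : int) n y t : -1 < t -> -1 < t + 2 * sg%:~R ->
  sg \in [:: -1; 0; 1] ->
  \sum_(a : 'I_5 | (sg + (a%:Z - 2) \in [:: -1; 0; 1]) && (0 <= y%:Z + (a%:Z - 2)))
   (coef q (a%:Z - 2) (2 * sg) y t k)%:C *
     phi q u (t + 2 * sg%:~R) n (absz (y%:Z + (a%:Z - 2))) k
  = (q ^+ (2 * n) * q `^ k)%:C * phi q u t n y k.
Proof.
move=> ht ht' hsg.
set P := fun e : int => (sg + e \in [:: -1; 0; 1]) && (0 <= y%:Z + e).
set G := fun e : int => (coef q e (2 * sg) y t k)%:C *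
     phi q u (t + 2 * sg%:~R) n (absz (y%:Z + e)) k.
transitivity (\sum_(e <- [:: -2; -1; 0; 1; 2] | P e) G e).
  by rewrite big_mkcond !big_ord_recl big_ord0 [RHS]big_mkcond !big_cons big_nil.
have Bq (m : int) : cpow q ((t + 2 * m%:~R)%:C - u + (k / 2 + 1 / 2)%:C) =
   cpow q (t%:C - u + (k / 2 + 1 / 2)%:C) * (q `^ (2 * m%:~R))%:C.
  rewrite -cpow_real // -cpowD //; congr (cpow q _); rewrite rmorphD; ring.
have qn : ((q `^ 2)%:C ^+ n = (q ^+ (2 * n))%:C)%R.
  by rewrite -rmorphXn exprM -(powR_mulrn 2 (ltW q0)).
rewrite !big_cons big_nil {}/P {}/G.
move: hsg ht'; rewrite !inE => /or3P[] /eqP -> ht'.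
- have -> : (0 <= y%:Z + 0) by lia.
  have -> : (0 <= y%:Z + 1) by lia.
  have -> : (0 <= y%:Z + 2) by lia.
  have -> : absz (y%:Z + 0) = y by lia.
  have -> : absz (y%:Z + 1) = y.+1 by lia.
  have -> : absz (y%:Z + 2) = y.+2 by lia.
  rewrite /= /coef /=.
  rewrite !(phi_polyE hq) Bq (_ : t + 2 * (-1)%:~R = t - 2); last by ring.
  rewrite exprMn -rmorphXn (_ : q `^ (2 * (-1)%:~R) ^+ n = (q ^+ (2 * n))^-1);
    last by rewrite mulrN1z mulrN mulr1 powRN exprVn exprM -(powR_mulrn 2 (ltW q0)).
  set B := cpow q _ ^+ n; set N := q ^+ (2 * n).
  have N0 : N != 0 by rewrite expf_neq0 // gt_eqF.
  transitivity (B * (N^-1 * (c_0_m2 q y t k * phi_poly q k n y (t - 2) +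
    c_1_m2 q y t k * phi_poly q k n y.+1 (t - 2) +
    c_2_m2 q y t k * phi_poly q k n y.+2 (t - 2)))%:C).
    by rewrite !(rmorphM, rmorphD); ring.
  rewrite (phi_poly_down2 hq hk) //; last by move: ht'; rewrite mulrN1z; lra.
  rewrite -/N [RHS]mulrCA -rmorphM; congr (_ * _%:C).
  by field.
- have -> : (0 <= y%:Z + 0) by lia.
  have -> : (0 <= y%:Z + 1) by lia.
  have -> : absz (y%:Z + 0) = y by lia.
  have -> : absz (y%:Z + 1) = y.+1 by lia.
  rewrite !mulr0z !mulr0 !addr0 /=.
  transitivity ((c_m1_0 q y t k)%:C * phi q u t n y.-1 k +
     (c_0_0 q y t k)%:C * phi q u t n y k +
     (c_1_0 q y t k)%:C * phi q u t n y.+1 k).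
    case: y => [|y]; first by rewrite [c_m1_0 _ _ _ _]/c_m1_0 /= mul0r add0r.
    have -> : (0 <= y.+1%:Z - 1) by lia.
    have -> : absz (y.+1%:Z - 1) = y by lia.
    by rewrite addrA.
  rewrite !(phi_polyE hq) [RHS]mulrCA.
  rewrite !(mulrCA _ (cpow _ _ ^+ n)) -!mulrDr -!(rmorphM (real_complex R)).
  by rewrite -!(rmorphD (real_complex R)) (phi_poly_same hq hk) // (mulrC (q `^ k)).
- have -> : (0 <= y%:Z + 0) by lia.
  have -> : absz (y%:Z + 0) = y by lia.
  rewrite !addr0 /=.
  rewrite (_ : t + 2 * 1%:~R = t + 2); last by ring.
  have E2 y' : phi q u (t + 2) n y' k = cpow q (t%:C - u + (k / 2 + 1 / 2)%:C) ^+ n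
     * (q ^+ (2 * n) * phi_poly q k n y' (t + 2))%:C.
    rewrite (phi_polyE hq) -[t + 2](_ : t + 2 * 1%:~R = _); last by ring.
    by rewrite Bq mulr1 exprMn qn -mulrA -rmorphM.
  (* At y = 0 only the shift 0 is admissible, with coefficient q^k. *)
  rewrite [in RHS](phi_polyE hq); case: y => [|y].
    by rewrite /coef /= E2 !phi_poly0 // !mulr1 /c_0_2 /= rmorphM; ring.
  have -> : (0 <= y.+1%:Z - 1) by lia.
  have -> : absz (y.+1%:Z - 1) = y by lia.
  transitivity ((c_m2_2 q y.+1 t k)%:C * phi q u (t + 2) n y.-1 k +
     (c_m1_2 q y.+1 t k)%:C * phi q u (t + 2) n y k +
     (c_0_2 q y.+1 t k)%:C * phi q u (t + 2) n y.+1 k).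
    case: y => [|y].
      by rewrite [c_m2_2 _ _ _ _]c_m2_2_1 mul0r add0r.
    have -> : (0 <= y.+2%:Z - 2) by lia.
    have -> : absz (y.+2%:Z - 2) = y by lia.
    by rewrite addrA.
  rewrite !E2 [RHS]mulrCA.
  rewrite !(mulrCA _ (cpow _ _ ^+ n)) -!mulrDr -!(rmorphM (real_complex R)).
  rewrite -!(rmorphD (real_complex R)); congr (_ * _%:C).
  by rewrite -[RHS]mulrA -(phi_poly_up2 hq hk) //; ring.
Qed.

End CoefSum.

(** * Heights and their behaviour under shifts *)

Section Heights.
Variables (R : realType) (M : nat) (k : 'I_M -> R).
Hypothesis hk : forall i, 0 < k i.
Implicit Types (y : {ffun 'I_M -> nat}) (e : {ffun 'I_M -> 'I_5}) (t : R).

Lemma big_ltnS (T : Type) (idx : T) (op : Monoid.com_law idx) (m : nat)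
    (F : 'I_M -> T) (i : 'I_M) : (m <= i)%N ->
  \big[op/idx]_(l < M | (m <= l < i.+1)%N) F l =
  op (\big[op/idx]_(l < M | (m <= l < i)%N) F l) (F i).
Proof.
move=> mi; rewrite (bigD1 i) /= ?mi ?ltnSn // Monoid.mulmC; congr (op _ _).
apply: eq_bigl => l; rewrite -val_eqE /= ltnS [in RHS]ltn_neqAle.
by rewrite -andbA; congr (_ && _); rewrite andbC.
Qed.

Lemma heightS y t (i : 'I_M) :
  height k y t i.+1 = height k y t i + (2 * (y i)%:R + k i).
Proof. by rewrite /height (@big_ltnS _ _ _ 0) // addrA. Qed.

Lemma height_ge y t i : t <= height k y t i.
Proof.
rewrite /height lerDl sumr_ge0 // => l _.
by rewrite addr_ge0 ?mulr_ge0 // ltW.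
Qed.

(** The height moves by m_i, the second index of the coefficient. Nonnegativity below i ensures that
    [absz] in [add_eps] changes nothing there. *)
Lemma height_add_eps y e t i :
  (forall l : 'I_M, (l < i)%N -> 0 <= (y l)%:Z + eps e l) ->
  height k (add_eps y e) t i =
  height k y t i + 2 * (\sum_(l < M | (l < i)%N) eps e l)%:~R.
Proof.
move=> h; rewrite /height -addrA; congr (_ + _).
rewrite (raddf_sum (intr : {additive int -> R})) mulr_sumr -big_split /=.
apply: eq_bigr => l li; rewrite ffunE.
have -> : (absz ((y l)%:Z + eps e l))%:R = (y l)%:R + (eps e l)%:~R :> R.
  by rewrite pmulrn gez0_abs ?h // intrD.
by rewrite mulrDr; ring.
Qed.

End Heights.

(** * The multivariate sum over shifts *)

Section MultivariateTransfer.
Variables (R : realType) (q : R).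
Hypothesis hq : 0 < q < 1.
Variables (M : nat) (k : 'I_M -> R).
Hypothesis hk : forall i, 0 < k i.
Implicit Types (n y : {ffun 'I_M -> nat}) (e : {ffun 'I_M -> 'I_5}) (t : R).

Definition Wcoef n (i : 'I_M) : R := q ^+ (2 * n i) * q `^ (k i).

Lemma eps_upd e i a l :
  eps (upd e i a) l = if l == i then a%:Z - 2 else eps e l.
Proof. by rewrite /eps ffunE; case: eqP. Qed.

(** An instance of [sum_prod_fiber], whose fibre sums are [coef_phi_sum] in the last j components
    and single terms in the others. *)
Lemma Ccoef_Phi_sum (j : nat) v t n y : -1 < t ->
  \sum_(e in Eset M j | admissible y e)
     (Ccoef q k j e y t)%:C * Phi q k v t n (add_eps y e) =
  (\prod_(i < M | (M - j <= i)%N) Wcoef n i)%:C * Phi q k v t n y.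
Proof.
move=> ht; set m := (M - j)%N.
pose psum e (i : 'I_M) := \sum_(l < M | (l < i)%N) eps e l.
(* The conjunction of these over i is membership in E_j together with admissibility. *)
pose ok (i : 'I_M) e := [&& (i < m)%N ==> (eps e i == 0),
  \sum_(l < M | (l <= i)%N) eps e l \in [:: -1; 0; 1] &
  0 <= (y i)%:Z + eps e i].
pose f (i : 'I_M) e := (if (m <= i)%N then
    (coef q (eps e i) (2 * psum e i) (y i) (height k y t i) (k i))%:C else 1) *
  phi q v (height k y t i + 2 * (psum e i)%:~R) (n i) (absz ((y i)%:Z + eps e i)) (k i).
pose T (i : 'I_M) := (if (m <= i)%N then (Wcoef n i)%:C else 1) *
  phi q v (height k y t i) (n i) (y i) (k i).
have psumS e (i : 'I_M) : \sum_(l < M | (l <= i)%N) eps e l = psum e i + eps e i.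
  by have := @big_ltnS M _ _ (@GRing.add int) 0 (eps e) i; apply.
have psum_loc (i : 'I_M) e e' : (forall l : 'I_M, (l < i)%N -> e l = e' l) ->
    psum e i = psum e' i.
  by move=> h; apply: eq_bigr => l li; rewrite /eps h.
have eps_loc (i : 'I_M) e e' : (forall l : 'I_M, (l <= i)%N -> e l = e' l) ->
    eps e i = eps e' i by move=> h; rewrite /eps h.
have psum_loc' (i : 'I_M) e e' : (forall l : 'I_M, (l <= i)%N -> e l = e' l) ->
    psum e i = psum e' i by move=> h; apply: psum_loc => l /ltnW; exact: h.
transitivity (\sum_(e : {ffun 'I_M -> 'I_5} | [forall i, ok i e]) \prod_i f i e).
  apply: eq_big => [e|e /andP[_ /forallP he]].
    rewrite inE; apply/andP/forallP => [[/andP[/forallP h1 /forallP h2] /forallP h3] i|h].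
      by rewrite /ok h1 h2 h3.
    by split; [apply/andP; split|]; apply/forallP => i; case/and3P: (h i).
  rewrite /Ccoef rmorph_prod /Phi big_mkcond -big_split /=.
  apply: eq_bigr => i _; rewrite /f; congr (_ * _).
  by rewrite height_add_eps // ffunE.
rewrite (@sum_prod_fiber M 'I_5 ord0 _ ok f T).
- by rewrite /T big_split /= -big_mkcond -rmorph_prod.
- by move=> i e e' h; rewrite /ok !psumS (eps_loc i e e') // (psum_loc' i e e').
- by move=> i e e' h; rewrite /f (eps_loc i e e') // (psum_loc' i e e').
move=> i e he; set sg := psum e i.
have hsg : sg \in [:: -1; 0; 1].
  rewrite /sg /psum; case: i {sg} he => -[|i] iM he /=.
    by rewrite big_pred0 // inE.
  have := he (Ordinal (ltnW iM)) (ltnSn i); case/and3P => _ + _.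
  by congr (_ \in _).
(* The shifted value is the height of a vector with nonnegative entries, so it is at least t even
   when sg = -1. *)
have hh : -1 < height k y t i + 2 * sg%:~R.
  rewrite -height_add_eps; first exact: lt_le_trans (height_ge hk _ _ _).
  by move=> l /he /and3P[].
have upsum a : psum (upd e i a) i = sg.
  by apply: psum_loc => l li; rewrite ffunE -val_eqE /= ltn_eqF.
case: (leqP m i) => mi.
  rewrite /T mi -(coef_phi_sum hq (hk i) v (n i) (y i) _ hh hsg); last first.
    exact: lt_le_trans (height_ge hk _ _ _).
  apply: eq_big => [a|a _].
    by rewrite /ok psumS upsum ltnNge mi /= eps_upd eqxx.
  by rewrite /f mi upsum eps_upd eqxx.
have sg0 : sg = 0.
  rewrite /sg /psum big1 // => l li; have /and3P[+ _ _] := he l li.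
  by rewrite (ltn_trans li mi) => /eqP.
(* Before the last j components only the shift 0 is allowed, encoded by the ordinal 2. *)
rewrite (big_pred1 (Ordinal (isT : (2 < 5)%N))) => [|a].
  rewrite /f /T leqNgt mi /= upsum sg0 eps_upd eqxx /= mulr0z mulr0 addr0.
  by congr (_ * phi _ _ _ _ _ _); lia.
rewrite /ok psumS upsum sg0 mi eps_upd eqxx /= add0r.
apply/idP/eqP => [/and3P[/eqP ha _ _]|->]; last by rewrite subrr addr0.
apply: val_inj => /=; move: ha; lia.
Qed.

End MultivariateTransfer.

(** * Raising and lowering operators in n *)

Section Operators.
Variables (R : realType) (q : R).
Hypothesis hq : 0 < q < 1.
Variables (M : nat) (k : 'I_M -> R).
Hypothesis hk : forall i, 0 < k i.
Implicit Types (n x y : {ffun 'I_M -> nat}) (e : {ffun 'I_M -> 'I_5}) (s t : R).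

Let q0 : 0 < q. Proof. by case/andP: hq. Qed.

Definition Wprod (m : nat) n (r : nat) : R :=
  \prod_(l < M | (m <= l < r)%N) Wcoef q k n l.

(** The prefix product collects the factors of components m to i - 1 that are still present when
    [phi_rec] is applied to component i. *)
Definition Zplus m (f : {ffun 'I_M -> nat} -> R[i]) n : R[i] :=
  \sum_(i < M | (m <= i)%N)
    (Wprod m n i * raise_coef q (k i) (n i))%:C * f (upd n i (n i).+1).
Definition Zminus m (f : {ffun 'I_M -> nat} -> R[i]) n : R[i] :=
  \sum_(i < M | (m <= i)%N)
    (Wprod m n i * lower_coef q (k i) (n i))%:C * f (upd n i (n i).-1).

Lemma Phi_upd u s n x (i : 'I_M) a :
  Phi q k u s (upd n i a) x = phi q u (height k x s i) a (x i) (k i) *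
    \prod_(l < M | l != i) phi q u (height k x s l) (n l) (x l) (k l).
Proof.
rewrite /Phi (bigD1 i) //= ffunE eqxx; congr (_ * _).
by apply: eq_bigr => l /negbTE li; rewrite ffunE li.
Qed.

Lemma upd_id n (i : 'I_M) : upd n i (n i) = n.
Proof. by apply/ffunP => l; rewrite ffunE; case: eqP => // ->. Qed.

(** Induction on the upper end r of the window: as h_{r+1} = h_r + 2 x_r + k_r (counting from 0),
    [phi_rec] for component r trades its factor and {h_{r+1}} for {h_r} plus one raising and one
    lowering term. *)
Lemma Phi_rec u s n x m : (m <= M)%N ->
  (Wprod m n M)%:C * qbrace q (height k x s M)%:C * Phi q k u s n x =
  qbrace q (height k x s m)%:C * Phi q k u s n x
  + cpow q (u - 1) * Zplus m (fun n => Phi q k u s n x) n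
  + cpow q (1 - u) * Zminus m (fun n => Phi q k u s n x) n.
Proof.
move=> mM; set F := fun n => Phi q k u s n x.
pose Z r := \sum_(i < M | (m <= i < r)%N) (Wprod m n i)%:C *
  (cpow q (u - 1) * (raise_coef q (k i) (n i))%:C * F (upd n i (n i).+1) +
   cpow q (1 - u) * (lower_coef q (k i) (n i))%:C * F (upd n i (n i).-1)).
have H r : (m <= r)%N -> (r <= M)%N ->
   (Wprod m n r)%:C * qbrace q (height k x s r)%:C * F n =
   qbrace q (height k x s m)%:C * F n + Z r.
  elim: r => [|r IH]; rewrite leq_eqVlt => /predU1P[<- _|mr rM] //.
  1,2: have E l : (m <= l < m)%N = false by rewrite ltnNge; case: leqP.
  1,2: by rewrite /Z /Wprod !big_pred0 ?mul1r ?addr0.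
  pose i := Ordinal rM.
  rewrite /Z (@big_ltnS _ _ _ _ _ _ i) // addrA -/(Z r) -IH ?(ltnW rM) //.
  rewrite /Wprod (@big_ltnS _ _ _ _ _ _ i) // -/(Wprod m n r) (heightS k x s i) /=.
  rewrite -[F n]/(Phi q k u s n x) -(upd_id n i) /F !Phi_upd /= (upd_id n i).
  set c := \prod_(l < M | l != i) _.
  rewrite rmorphM /=.
  transitivity ((Wprod m n r)%:C * c * ((q ^+ (2 * n i) * q `^ (k i))%:C *
     qbrace q (height k x s i + (2 * (x i)%:R + k i))%:C *
     phi q u (height k x s i) (n i) (x i) (k i))).
    by rewrite /Wcoef; ring.
  by rewrite (phi_rec hq (hk i)); ring.
rewrite H // -addrA; congr (_ + _); rewrite /Z /Zplus /Zminus !mulr_sumr -big_split /=.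
apply: eq_big => [i|i _]; first by rewrite ltn_ord andbT.
by rewrite !(rmorphM (real_complex R)) /=; ring.
Qed.

Lemma Wprod_neq0 m n r : Wprod m n r != 0.
Proof.
rewrite prodf_seq_neq0; apply/allP => i _; apply/implyP => _.
by rewrite mulf_neq0 ?expf_neq0 ?gt_eqF ?powR_gt0.
Qed.

Lemma Wprod_upd m n (i : 'I_M) a : (m <= i)%N ->
  Wprod m (upd n i a) M * q ^+ (2 * n i) = Wprod m n M * q ^+ (2 * a).
Proof.
move=> mi; rewrite /Wprod (bigD1 i) ?mi ?ltn_ord //=.
rewrite [in RHS](bigD1 i) ?mi ?ltn_ord //= /Wcoef ffunE eqxx.
rewrite (eq_bigr (fun l => q ^+ (2 * n l) * q `^ (k l))); first by ring.
by move=> l /andP[_ /negbTE li]; rewrite ffunE li.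
Qed.

(** The q-commutation: raising any component i >= m by one multiplies [Wprod m n M] by q^2. *)
Lemma Zplus_Wprod m f n : Zplus m (fun n => (Wprod m n M)%:C * f n) n =
  (q ^+ 2 * Wprod m n M)%:C * Zplus m f n.
Proof.
rewrite /Zplus mulr_sumr; apply: eq_bigr => i mi.
have := Wprod_upd n (n i).+1 mi; rewrite mulnS exprD => h.
have {h} -> : Wprod m (upd n i (n i).+1) M = q ^+ 2 * Wprod m n M.
  by apply: (mulIf (expf_neq0 (2 * n i) (lt0r_neq0 q0))); rewrite h; ring.
by ring.
Qed.

Lemma Zminus_Wprod m f n : Zminus m (fun n => (Wprod m n M)%:C * f n) n =
  (q ^- 2 * Wprod m n M)%:C * Zminus m f n.
Proof.
rewrite /Zminus mulr_sumr; apply: eq_bigr => i mi.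
case ni : (n i) => [|a].
  by rewrite /lower_coef muln0 expr0 subrr !(mulr0, mul0r).
have := Wprod_upd n a mi; rewrite ni mulnS exprD => h.
have {h} -> : Wprod m (upd n i a) M = q ^- 2 * Wprod m n M.
  apply: (mulIf (expf_neq0 (2 * a) (lt0r_neq0 q0))).
  apply: (mulIf (expf_neq0 2 (lt0r_neq0 q0))).
  rewrite -mulrA [q ^+ (2 * a) * _]mulrC h; field; exact: lt0r_neq0.
by ring.
Qed.

Lemma Zplus_sum m (I : finType) (P : pred I) (c : I -> R[i])
    (f : I -> {ffun 'I_M -> nat} -> R[i]) n :
  Zplus m (fun n => \sum_(e | P e) c e * f e n) n =
  \sum_(e | P e) c e * Zplus m (f e) n.
Proof.
rewrite /Zplus; under [RHS]eq_bigr do rewrite mulr_sumr.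
rewrite [RHS]exchange_big /=; apply: eq_bigr => i _; rewrite mulr_sumr.
by apply: eq_bigr => e _; rewrite mulrCA.
Qed.

Lemma Zminus_sum m (I : finType) (P : pred I) (c : I -> R[i])
    (f : I -> {ffun 'I_M -> nat} -> R[i]) n :
  Zminus m (fun n => \sum_(e | P e) c e * f e n) n =
  \sum_(e | P e) c e * Zminus m (f e) n.
Proof.
rewrite /Zminus; under [RHS]eq_bigr do rewrite mulr_sumr.
rewrite [RHS]exchange_big /=; apply: eq_bigr => i _; rewrite mulr_sumr.
by apply: eq_bigr => e _; rewrite mulrCA.
Qed.

End Operators.

(** * Origin of the D-coefficients *)

Section Commutation.
Variables (R : realType) (q : R).
Hypothesis hq : 0 < q < 1.
Variables (M : nat) (k : 'I_M -> R).
Hypothesis hk : forall i, 0 < k i.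
Implicit Types (n x y : {ffun 'I_M -> nat}) (e : {ffun 'I_M -> 'I_5}) (s t : R).

Let q0 : 0 < q. Proof. by case/andP: hq. Qed.

Lemma Eset_psum j e (r : nat) : e \in Eset M j ->
  \sum_(l < M | (l < r)%N) eps e l \in [:: -1; 0; 1].
Proof.
rewrite inE => /andP[_ /forallP h].
elim: r => [|r IH]; first by rewrite big_pred0.
case: (ltnP r M) => rM; first by have := h (Ordinal rM).
rewrite (eq_bigl (fun l : 'I_M => (l < r)%N)) // => l.
by rewrite !(leq_trans (ltn_ord l)) // leqW.
Qed.

Definition eps0 : {ffun 'I_M -> 'I_5} := [ffun=> Ordinal (isT : (2 < 5)%N)].

Lemma eps_eps0 i : eps eps0 i = 0.
Proof. by rewrite /eps ffunE. Qed.

Lemma eps0P e : [forall i, eps e i == 0] = (e == eps0).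
Proof.
apply/forallP/eqP => [h|-> i]; last by rewrite eps_eps0.
apply/ffunP => i; have := h i; rewrite /eps ffunE => /eqP hi.
by apply: val_inj => /=; lia.
Qed.

Lemma add_eps0 y : add_eps y eps0 = y.
Proof. by apply/ffunP => i; rewrite ffunE eps_eps0 addr0. Qed.

(** The C-sum weighted by {h_M(y + eps)} ([H1]) and by {h_M(y)} ([H2]) reduces each time to F, Z_+ F
    and Z_- F. D is the combination of the two, corrected at eps = 0, that leaves Z_+ F + Z_- F. *)
Lemma Dcoef_Phi_sum (j : nat) v t n y : -1 < t ->
  \sum_(e in Eset M j | admissible y e)
     Dcoef q k v j e y t * Phi q k v t n (add_eps y e) =
  Zplus q k (M - j) (fun n => Phi q k v t n y) n +
  Zminus q k (M - j) (fun n => Phi q k v t n y) n.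
Proof.
move=> ht; set m := (M - j)%N; have mM : (m <= M)%N by exact: leq_subr.
pose P e := (e \in Eset M j) && admissible y e.
pose S e : int := \sum_(l < M) eps e l.
set F := fun n => Phi q k v t n y.
pose cC e := (Ccoef q k j e y t)%:C.
pose Fe e n := Phi q k v t n (add_eps y e).
have ACF n' : \sum_(e | P e) cC e * Fe e n' = (Wprod q k m n' M)%:C * F n'.
  rewrite /cC /Fe Ccoef_Phi_sum //; congr (_%:C * _).
  by apply: eq_bigl => l; rewrite ltn_ord andbT.
have hM e : P e -> height k (add_eps y e) t M = height k y t M + 2 * (S e)%:~R.
  move=> /andP[_ /forallP he]; rewrite height_add_eps //.
  by congr (_ + 2 * _%:~R); apply: eq_bigl => l; rewrite ltn_ord.
have hm e : P e -> height k (add_eps y e) t m = height k y t m.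
  move=> /andP[]; rewrite inE => /andP[/forallP h _] /forallP he.
  rewrite height_add_eps // big1 ?mulr0z ?mulr0 ?addr0 // => l lm.
  by have := h l; rewrite lm => /eqP.
set V := cpow q v; set c := q%:C.
set Zp := Zplus q k m F n; set Zm := Zminus q k m F n.
set bm := qbrace q (height k y t m)%:C; set bM := qbrace q (height k y t M)%:C.
have c0 : c != 0 by rewrite fmorph_eq0 gt_eqF.
have cE : cpow q 1 = c by rewrite -[1]/(1%:C) cpow_real // powRr1 // ltW.
have V0 : V != 0 by exact: cpow_neq0.
have cVm : cpow q (v - 1) = V / c by rewrite cpowD // cpowN // cE.
have cVm' : cpow q (1 - v) = c / V by rewrite cpowD // cpowN // cE.
have A0 : (Wprod q k m n M)%:C != 0 by rewrite fmorph_eq0 Wprod_neq0.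
(* [Phi_rec] is applied at each y + eps before summing; moving A past Z_+ and Z_- turns q^(v-1) and
   q^(1-v) into q^(v+1) and q^(-v-1). *)
have H1 : \sum_(e | P e) cC e * qbrace q (height k (add_eps y e) t M)%:C * Fe e n
    = bm * F n + V * c * Zp + (c * V)^-1 * Zm.
  apply: (mulfI A0); rewrite mulr_sumr.
  transitivity (\sum_(e | P e) (bm * (cC e * Fe e n) +
     V / c * (cC e * Zplus q k m (Fe e) n) + c / V * (cC e * Zminus q k m (Fe e) n))).
    apply: eq_bigr => e he; rewrite -cVm -cVm' /bm -(hm e he).
    have := Phi_rec hq hk v t n (add_eps y e) mM.
    rewrite -/(Fe e n) -/(Fe e) => hrec.
    set b := qbrace q (height k _ t M)%:C in hrec *.
    transitivity (cC e * ((Wprod q k m n M)%:C * b * Fe e n)); first by ring.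
    by rewrite hrec; ring.
  rewrite !big_split /= -!mulr_sumr ACF.
  rewrite -Zplus_sum -Zminus_sum.
  have -> : (fun n0 => \sum_(e | P e) cC e * Fe e n0) =
     (fun n0 => (Wprod q k m n0 M)%:C * F n0) by apply/boolp.funext.
  rewrite (Zplus_Wprod hq) (Zminus_Wprod hq) -/Zp -/Zm.
  rewrite !rmorphM fmorphV rmorphXn -/c.
  by field; rewrite c0 V0.
(* Here the sum over eps comes first, so q^(v-1) and q^(1-v) stay. *)
have H2 : \sum_(e | P e) cC e * bM * Fe e n =
   bm * F n + V / c * Zp + c / V * Zm.
  rewrite -cVm -cVm' -(Phi_rec hq hk) // -/bM -/(F n) mulrAC -ACF mulr_suml.
  by apply: eq_bigr => e _; rewrite mulrAC.
have cc0 : c * c + 1 != 0.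
  rewrite -expr2 /c -rmorphXn -(rmorph1 (real_complex R)) -rmorphD fmorph_eq0.
  by rewrite gt_eqF // addr_gt0 ?exprn_gt0.
have c40 : (c * c) ^+ 2 - 1 != 0.
  rewrite -expr2 -exprM /c -rmorphXn -(rmorph1 (real_complex R)) -rmorphB fmorph_eq0 lt_eqF //.
  by rewrite subr_lt0 exprn_ilt1 ?ltW //; case/andP: hq.
(* [al] and [be] are chosen so that [al * {h + 2 sigma} + be * {h}] is
   [{h + v - 1}], [{h} * {v}], [{h - v + 1}] for sigma = -1, 0, 1. *)
pose al := (c / V - V / c) / (c ^+ 2 - c ^- 2).
pose be := c / V - al * c ^+ 2.
set H := cpow q (height k y t M)%:C.
have H0 : H != 0 by exact: cpow_neq0.
have qbE z : qbrace q z = (cpow q z + (cpow q z)^-1) / (c + c^-1).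
  by rewrite /qbrace cpowN // rmorphD fmorphV.
clearbody c.
have cpow2 : cpow q 2 = c ^+ 2 by rewrite -cE -cpow_mulrn // mulr1.
have HD e : P e -> Dcoef q k v j e y t =
    al * (cC e * qbrace q (height k (add_eps y e) t M)%:C) + be * (cC e * bM)
    - (if e == eps0 then bm * qbrace q v else 0).
  move=> he; have := Eset_psum M (andP he).1.
  rewrite (eq_bigl xpredT) => [|l]; last by rewrite ltn_ord.
  rewrite hM // /Dcoef -/(S e) -/(cC e) eps0P -/m /bM /bm.
  rewrite !inE => /or3P[] /eqP hS; rewrite hS /=.
  - case: eqP => [ee|_].
      by move: hS; rewrite ee /S big1 // => i _; rewrite eps_eps0.
    rewrite subr0 !qbE -/H mulrN1z mulrN mulr1.
    rewrite (_ : (height k y t M - 2)%:C = (height k y t M)%:C - 2); last first.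
      by rewrite (rmorphB (real_complex R)) rmorph_nat.
    rewrite !cpowD // !cpowN // cE ?cpow2 -/V -/H /be /al.
    by field; rewrite ?c0 ?V0 ?H0 ?cc0 ?c40.
  - rewrite mulr0z mulr0 addr0.
    set bv := qbrace q v.
    transitivity (cC e * qbrace q (height k y t M)%:C * bv -
      (if e == eps0 then qbrace q (height k y t m)%:C * bv else 0)).
      by case: ifP => _; rewrite ?subr0.
    congr (_ - _); rewrite /bv !qbE -/H -/V /be /al.
    by field; rewrite ?c0 ?V0 ?H0 ?cc0 ?c40.
  - case: eqP => [ee|_].
      by move: hS; rewrite ee /S big1 // => i _; rewrite eps_eps0.
    rewrite subr0 !qbE -/H mulr1.
    rewrite (_ : (height k y t M + 2)%:C = (height k y t M)%:C + 2); last first.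
      by rewrite (rmorphD (real_complex R)) rmorph_nat.
    rewrite !cpowD // !cpowN // cE ?cpow2 -/V -/H /be /al.
    by field; rewrite ?c0 ?V0 ?H0 ?cc0 ?c40.
transitivity (al * (\sum_(e | P e) cC e * qbrace q (height k (add_eps y e) t M)%:C * Fe e n)
   + be * (\sum_(e | P e) cC e * bM * Fe e n) - bm * qbrace q v * F n).
  have P0 : P eps0.
    apply/andP; split; last by apply/forallP => i; rewrite eps_eps0 addr0.
    rewrite inE; apply/andP; split; apply/forallP => i; rewrite ?eps_eps0 ?eqxx ?implybT //.
    by rewrite big1 // => l _; rewrite eps_eps0.
  rewrite !mulr_sumr -big_split /=.
  rewrite (bigD1 eps0) //= [in RHS](bigD1 eps0) //= HD // eqxx /Fe add_eps0 -/F.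
  rewrite (eq_bigr (fun e => al * (cC e * qbrace q (height k (add_eps y e) t M)%:C * Fe e n)
     + be * (cC e * bM * Fe e n))) => [|e /andP[he /negbTE e0]]; last first.
    by rewrite HD // e0 subr0 /Fe; ring.
  by rewrite -/(F n) -/Fe; ring.
(* Both al V c + be V / c and al / (c V) + be c / V equal 1, and al + be = {v}, so the terms in [bm]
   cancel. *)
rewrite H1 H2 qbE -/V /be /al.
by field; rewrite ?c0 ?V0 ?cc0 ?c40.
Qed.
End Commutation.

(* Unconditional sums *)
#[local] Existing Instance totally_filter.

Section HasSum.
Local Open Scope classical_set_scope.
Variables (R : realType) (I : choiceType).
Implicit Types (f g : I -> R[i]) (A B : {fset I}).

(** A relation, because the value [summability.sum] is informative only when the partial sums
    converge. *)
Definition has_sum f (S : R[i]) : Prop :=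
  partial_sum (f : I -> R[i]^o) @ totally --> (S : R[i]^o).

Lemma partial_sumE (V : zmodType) (f : I -> V) A :
  partial_sum f A = \sum_(i <- A) f i.
Proof. by rewrite /partial_sum big_seq_fsetE. Qed.

Lemma has_sum_unique f S S' : has_sum f S -> has_sum f S' -> S = S'.
Proof. exact: (@cvg_unique _ (@norm_hausdorff _ R[i]^o)). Qed.

Lemma has_sum_sum f S : has_sum f S ->
  summability.sum (f : I -> R[i]^o) = S.
Proof. exact: (@cvg_lim _ (@norm_hausdorff _ R[i]^o)). Qed.

Lemma has_sumD f g S T : has_sum f S -> has_sum g T ->
  has_sum (fun i => f i + g i) (S + T).
Proof.
move=> hf hg; rewrite /has_sum.
rewrite (_ : partial_sum _ = partial_sum (f : I -> R[i]^o) \+ partial_sum (g : I -> R[i]^o)).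
  exact: cvgD hf hg.
by apply/funext => A; rewrite /partial_sum /= big_split.
Qed.

Lemma has_sumZ c f S : has_sum f S -> has_sum (fun i => c * f i) (c * S).
Proof.
move=> hf; rewrite /has_sum.
rewrite (_ : partial_sum _ = fun A => (c : R[i]^o) * partial_sum (f : I -> R[i]^o) A).
  by apply: cvgMl_tmp.
by apply/funext => A; rewrite /partial_sum /= -mulr_sumr.
Qed.

Lemma has_sum0 : has_sum (fun=> 0) 0.
Proof.
rewrite /has_sum (_ : partial_sum _ = fun=> (0 : R[i]^o)); first exact: cvg_cst.
by apply/funext => A; rewrite /partial_sum big1.
Qed.

Lemma has_sum_sumr (J : finType) (P : pred J) (f : J -> I -> R[i]) (S : J -> R[i]) :
  (forall j, P j -> has_sum (f j) (S j)) ->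
  has_sum (fun i => \sum_(j | P j) f j i) (\sum_(j | P j) S j).
Proof.
move=> h; elim: (index_enum J) => [|j r IH].
  rewrite big_nil (_ : (fun i => _) = fun=> 0); first exact: has_sum0.
  by apply/funext => i; rewrite big_nil.
rewrite big_cons (_ : (fun i => _) = fun i =>
    if P j then f j i + \sum_(j <- r | P j) f j i else \sum_(j <- r | P j) f j i).
  by case: ifP => [/h hj|//]; exact: has_sumD.
by apply/funext => i; rewrite big_cons.
Qed.

Lemma has_sumP f S : has_sum f S <->
  (forall e : R, 0 < e -> exists A, forall B, (A `<=` B)%fset ->
    `|S - \sum_(i <- B) f i| < e%:C).
Proof.
split=> [/cvgrPdist_lt h e e0|h].
  have /h [A _ hA] : 0 < e%:C by rewrite ltcR.
  by exists A => B AB; have := hA B AB; rewrite /= partial_sumE.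
apply/cvgrPdist_lt => e e0.
have eE : e = (complex.Re e)%:C by rewrite RRe_real // gtr0_real.
have [|A hA] := h (complex.Re e); first by rewrite -ltcR -eE.
by exists A => // B AB; rewrite /= partial_sumE eE; exact: hA.
Qed.

(** [sg] is injective and f vanishes off its image: a finite set containing the image of A can be
    cut down to the image of [sg] and pulled back. *)
Lemma has_sum_reindex (sg tau : I -> I) f S : cancel sg tau ->
  (forall i, sg (tau i) != i -> f i = 0) ->
  has_sum (fun i => f (sg i)) S -> has_sum f S.
Proof.
move=> sgK f0 /has_sumP h; apply/has_sumP => e /h[A hA].
exists [fset sg i | i in A]%fset => B AB.
pose B0 := [fset tau i | i in B & sg (tau i) == i]%fset.
rewrite (_ : \sum_(i <- B) f i = \sum_(i <- B0) f (sg i)).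
  apply: hA; apply/fsubsetP => i iA; apply/imfsetP; exists (sg i); rewrite ?sgK //=.
  rewrite inE sgK eqxx andbT; apply: (fsubsetP AB); exact: in_imfset.
rewrite (bigID (fun i => sg (tau i) == i)) /= addrC big1 ?add0r; last first.
  by move=> i; exact: f0.
rewrite -big_filter; set F := [seq _ <- _ | _].
have hF i : i \in F -> sg (tau i) = i by rewrite mem_filter => /andP[/eqP].
transitivity (\sum_(i <- map tau F) f (sg i)).
  by rewrite big_map; apply: eq_big_seq => i /hF ->.
apply: perm_big; apply: uniq_perm.
- rewrite map_inj_in_uniq ?filter_uniq ?fset_uniq // => i j /hF hi /hF hj hij.
  by rewrite -hi -hj hij.
- exact: fset_uniq.
move=> i; apply/mapP/imfsetP => -[j hj ->]; exists j => //.
  by move: hj; rewrite mem_filter !inE andbC.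
by move: hj; rewrite mem_filter !inE andbC.
Qed.

(** The sum is the supremum of the finite partial sums, which grow with the index set. *)
Lemma has_sum_nonneg (h : I -> R) (C : R) : (forall i, 0 <= h i) ->
  (forall A : {fset I}, \sum_(i <- A) h i <= C) ->
  exists S, has_sum (fun i => (h i)%:C) S.
Proof.
move=> h0 hC; pose E := [set \sum_(i <- A) h i | A in @setT {fset I}].
have supE : has_sup E.
  split; first by exists (\sum_(i <- fset0) h i); exists fset0.
  by exists C => _ [A _ <-].
exists (sup E)%:C; apply/has_sumP => e e0.
have [_ [A _ <-] hA] := sup_adherent e0 supE; exists A => B AB.
have AB' : \sum_(i <- A) h i <= \sum_(i <- B) h i.
  rewrite (eq_big_seq (fun i => if i \in A then h i else 0)) => [|i ->] //.
  rewrite (big_fset_incl _ AB) => [|i _ /negbTE ->] //.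
  by apply: ler_sum => i _; case: ifP.
have BS : \sum_(i <- B) h i <= sup E by apply: ub_le_sup; [case: supE|exists B].
rewrite -(rmorph_sum (real_complex R)) -rmorphB ger0_norm ?lecR ?subr_ge0 //.
by rewrite ltcR; lra.
Qed.

(** The real and imaginary parts h are each a difference (h + g) - g of summable nonnegative
    families. *)
Lemma has_sum_dominated (f : I -> R[i]) (g : I -> R) (C : R) :
  (forall i, `|f i| <= (g i)%:C) ->
  (forall A : {fset I}, \sum_(i <- A) g i <= C) ->
  exists S, has_sum f S.
Proof.
move=> fg hC.
have g0 i : 0 <= g i by rewrite -lecR; exact: le_trans (normr_ge0 _) (fg i).
have rg i : `|complex.Re (f i)| <= g i.
  by rewrite -lecR; exact: le_trans (normc_ge_Re _) (fg i).
have ig i : `|complex.Im (f i)| <= g i.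
  rewrite -lecR; apply: le_trans (fg i); rewrite normc_def lecR -sqrtr_sqr.
  by rewrite ler_wsqrtr // lerDr sqr_ge0.
have H (h : I -> R) : (forall i, `|h i| <= g i) -> exists S, has_sum (fun i => (h i)%:C) S.
  move=> hg; have [|A|S hS] := @has_sum_nonneg (fun i => h i + g i) (C + C).
  - by move=> i; have := hg i; rewrite ler_norml => /andP[? ?]; lra.
  - rewrite big_split /= lerD //; apply: le_trans (hC A); apply: ler_sum => i _.
    exact: le_trans (ler_norm _) (hg i).
  have [//|T hT] := @has_sum_nonneg g C g0.
  exists (S + -1 * T).
  rewrite (_ : (fun i => _) = fun i => (h i + g i)%:C + -1 * (g i)%:C).
    by apply: has_sumD => //; exact: has_sumZ.
  by apply/funext => i; rewrite rmorphD; ring.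
have [S hS] := H _ rg; have [T hT] := H _ ig.
exists (S + 'i * T).
rewrite (_ : f = fun i => (complex.Re (f i))%:C + 'i * (complex.Im (f i))%:C).
  by apply: has_sumD => //; exact: has_sumZ.
by apply/funext => i; rewrite -complexE.
Qed.
End HasSum.

(** * Geometric majorants in several variables *)

Section GeometricBound.
Variables (R : realType) (M : nat) (r : R).
Hypotheses (r0 : 0 <= r) (r1 : r < 1).

Lemma sum_geometric_le N : \sum_(a < N) r ^+ a <= (1 - r)^-1.
Proof.
have h : 0 < 1 - r by rewrite subr_gt0.
rewrite -[leRHS]mul1r ler_pdivlMr // mulrC -[X in X * _]opprB mulNr -subrX1 opprB.
by rewrite gerBl exprn_ge0.
Qed.

(** A finite set lies in a box {0, ..., N}^M, over which the sum is a product of geometric sums. *)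
Lemma sum_fset_geometric_le (A : {fset {ffun 'I_M -> nat}}) :
  \sum_(n <- A) \prod_i r ^+ n i <= (1 - r)^-1 ^+ M.
Proof.
pose N := (\max_(n <- A) \max_i n i)%N.
have nN n i : n \in A -> (n i < N.+1)%N.
  move=> nA; rewrite ltnS; apply: (@bigmaxn_sup_seq _ _ n) => //.
  exact: leq_bigmax.
pose emb (m : {ffun 'I_M -> 'I_N.+1}) : {ffun 'I_M -> nat} := [ffun i => m i : nat].
pose prj (n : {ffun 'I_M -> nat}) : {ffun 'I_M -> 'I_N.+1} := [ffun i => inord (n i)].
have embK : cancel emb prj.
  by move=> m; apply/ffunP => i; rewrite !ffunE inord_val.
have prjK n : n \in A -> emb (prj n) = n.
  by move=> nA; apply/ffunP => i; rewrite !ffunE inordK // nN.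
pose E := [seq m <- enum {ffun 'I_M -> 'I_N.+1} | emb m \in A].
have -> : \sum_(n <- A) \prod_i r ^+ n i = \sum_(m <- E) \prod_i r ^+ m i.
  transitivity (\sum_(n <- map emb E) \prod_i r ^+ n i).
    apply: perm_big; apply: uniq_perm; first exact: fset_uniq.
      by rewrite (map_inj_uniq (can_inj embK)) filter_uniq ?enum_uniq.
    move=> n; apply/idP/mapP => [nA|[m + ->]].
      exists (prj n); last by rewrite prjK.
      by rewrite mem_filter prjK // nA mem_enum.
    by rewrite mem_filter => /andP[].
  rewrite big_map; apply: eq_bigr => m _; apply: eq_bigr => i _.
  by rewrite ffunE.
rewrite big_filter big_enum_cond /=.
apply: (@le_trans _ _ (\sum_(m : {ffun 'I_M -> 'I_N.+1}) \prod_i r ^+ m i)).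
  rewrite big_mkcond; apply: ler_sum => m _; case: ifP => // _.
  by apply: prodr_ge0 => i _; rewrite exprn_ge0.
rewrite -(bigA_distr_bigA (fun (i : 'I_M) (a : 'I_N.+1) => r ^+ a)) /=.
rewrite prodr_const card_ord lerXn2r ?nnegrE ?sumr_ge0 ?sum_geometric_le //.
- by move=> i _; rewrite exprn_ge0.
- by rewrite invr_ge0 subr_ge0 ltW.
Qed.

Lemma has_sum_geometric (C : R) (f : {ffun 'I_M -> nat} -> R[i]) :
  (forall n, `|f n| <= (C * \prod_i r ^+ n i)%:C) -> exists S, has_sum f S.
Proof.
move=> h; have C0 : 0 <= C.
  have := le_trans (normr_ge0 _) (h [ffun=> 0%N]).
  by rewrite big1 ?mulr1 ?lecR // => i _; rewrite ffunE expr0.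
apply: (has_sum_dominated h (C := C * (1 - r)^-1 ^+ M)) => A.
by rewrite -mulr_sumr ler_wpM2l // sum_fset_geometric_le.
Qed.

End GeometricBound.

(** * Growth of [phi] and of the weight in n *)

Lemma norm_real_complex (R : realType) (r : R) : `|r%:C| = `|r|%:C.
Proof. by rewrite normc_def /= expr0n addr0 sqrtr_sqr. Qed.

Section UnivariateBounds.
Variables (R : realType) (q : R).
Hypothesis hq : 0 < q < 1.
Let q0 : 0 < q. Proof. by case/andP: hq. Qed.
Let q1 : q < 1. Proof. by case/andP: hq. Qed.

(** The factors 1 - q^(2(n-i)) lie in [0, 1] for i <= n, and the one at i = n is zero. *)
Lemma qpoch_norm_le1 n l : `|qpoch (q ^+ (2 * n)) (q ^- 2) l| <= 1.
Proof.
case: (ltnP n l) => ln.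
  by rewrite (qpoch_eq0 (qV2_mul_pow hq n) ln) normr0.
rewrite /qpoch normr_prod; apply: prodr_ile1 => i _; rewrite normr_ge0 /=.
have /andP[i0 i1] : 0 <= q ^+ (2 * n) * q ^- 2 ^+ i <= 1.
  have iN : (i <= n)%N by rewrite ltnW // (leq_trans (ltn_ord i)).
  rewrite -(subnK iN) mulnDr exprD -mulrA qV2_mul_pow // mulr1.
  by rewrite exprn_ge0 ?exprn_ile1 // ltW.
by rewrite ger0_norm ?subr_ge0 // gerBl.
Qed.

(** Cut after x + 1 terms, the series depends on n only through (q^(2n); q^-2)_l, which is at most 1
    in absolute value. *)
Lemma phi_bound u s x k : exists C : R, forall n,
  `|phi q u s n x k| <=
  (C * q `^ (s - complex.Re u + (k / 2 + 1 / 2)) ^+ n)%:C.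
Proof.
pose c l := qpoch (q ^+ (2 * x)) (q ^- 2) l *
  qpoch (q `^ (- 2 * x%:R - 2 * s - 2 * k)) (q ^- 2) l /
  (qpoch (q `^ (- 2 * k)) (q ^- 2) l * qpoch (q ^- 2) (q ^- 2) l) * q ^- 2 ^+ l.
exists (\sum_(l < x.+1) `|c l|) => n.
rewrite (phiE hq _ _ _ (L := x.+1)) ?ltnS ?geq_minr //.
rewrite normrM normrX cpow_norm // norm_real_complex.
have -> : complex.Re (s%:C - u + (k / 2 + 1 / 2)%:C) =
    s - complex.Re u + (k / 2 + 1 / 2) by case: u.
rewrite -rmorphXn -rmorphM lecR mulrC ler_wpM2r ?exprn_ge0 ?powR_ge0 //.
apply: le_trans (ler_norm_sum _ _ _) _; apply: ler_sum => l _.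
rewrite -[leRHS]mul1r; apply: le_trans (ler_wpM2r (normr_ge0 _) (qpoch_norm_le1 n l)).
by rewrite -normrM /c !mulrA.
Qed.

(** Each factor of the Pochhammer quotient is at most exp(z / (1 - q^2)) with z = q^(2i+2), and
    these exponents have bounded sums. *)
Lemma weight_bound k : 0 < k -> exists C : R, forall n,
  `|weight q k n| <= C * q `^ (1 - k) ^+ n.
Proof.
move=> k0; have qq0 : 0 <= q ^+ 2 by rewrite exprn_ge0 // ltW.
have qq1 : q ^+ 2 < 1 by rewrite exprn_ilt1 // ltW.
have h1 : 0 < 1 - q ^+ 2 by rewrite subr_gt0.
pose c := q ^+ 2 / (1 - q ^+ 2).
exists (expR (c / (1 - q ^+ 2))) => n; rewrite /weight.
rewrite (_ : - n%:R * (k - 1) = (1 - k) * n%:R); last by ring.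
rewrite (powRrM q (1 - k) n%:R) (powR_mulrn n (powR_ge0 q (1 - k))) normrM mulrC.
rewrite [X in _ * X]ger0_norm ?exprn_ge0 ?powR_ge0 // ler_wpM2r ?exprn_ge0 ?powR_ge0 //.
rewrite /qpoch -prodf_div normr_prod.
apply: (@le_trans _ _ (\prod_(i < n) expR (c * q ^+ 2 ^+ i))).
  apply: ler_prod => i _; rewrite normr_ge0 /= normrM normfV.
  set z := q ^+ 2 * q ^+ 2 ^+ i.
  have zi : z <= q ^+ 2 by rewrite ler_piMr // exprn_ile1 // ltW.
  have z0 : 0 <= z by rewrite mulr_ge0 ?exprn_ge0 ?ltW.
  have z1 : 0 < 1 - z by rewrite subr_gt0 (le_lt_trans zi).
  rewrite [X in _ / X]gtr0_norm // ler_pdivrMr //.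
  have a1 : `|1 - q `^ (2 * k) * q ^+ 2 ^+ i| <= 1.
    have qk : 0 <= q `^ (2 * k) * q ^+ 2 ^+ i <= 1.
      apply/andP; split; first by rewrite mulr_ge0 ?powR_ge0 ?exprn_ge0 // ltW.
      apply: mulr_ile1; rewrite ?powR_ge0 //.
      - by rewrite exprn_ge0 // exprn_ge0 // ltW.
      - by rewrite -[leRHS](powRr0 q) ger_powR ?q0 ?ltW // mulr_gt0.
      - by rewrite exprn_ile1 // ltW.
    by case/andP: qk => ? ?; rewrite ger0_norm ?subr_ge0 // gerBl.
  apply: le_trans a1 _; rewrite (_ : c * _ = z / (1 - q ^+ 2)); last by rewrite /c /z; ring.
  apply: (@le_trans _ _ ((1 + z / (1 - q ^+ 2)) * (1 - z))); last first.
    by rewrite ler_pM2r // expR_ge1Dx.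
  rewrite -subr_ge0 (_ : _ - 1 = z * (q ^+ 2 - z) / (1 - q ^+ 2)).
    apply: divr_ge0; last exact: ltW.
    by apply: mulr_ge0; rewrite ?subr_ge0.
  by field; rewrite gt_eqF.
rewrite -expR_sum ler_expR -mulr_sumr; apply: ler_wpM2l; last exact: sum_geometric_le.
by apply: divr_ge0 => //; exact: ltW.
Qed.

(** Detailed balance: raising and lowering are adjoint with respect to the weight. *)
Lemma weight_raise_lower k n : 0 < k ->
  weight q k n.+1 * lower_coef q k n.+1 = weight q k n * raise_coef q k n.
Proof.
move=> k0; rewrite /weight /lower_coef /raise_coef !qpochS.
have qn0 : q != 0 by rewrite gt_eqF.
have -> : q `^ (2 * k) = q `^ k ^+ 2 by rewrite mulrC powRrM powR_mulrn ?powR_ge0.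
have -> : q `^ (- n.+1%:R * (k - 1)) = q `^ (- n%:R * (k - 1)) *
    (q `^ (1 / 2 - k / 2) * q `^ (1 / 2 - k / 2)).
  by rewrite -!powRD ?qn0 ?implybT //; congr (_ `^ _); rewrite -(natr1 n); field.
have e1 : q `^ (1 / 2 - k / 2) * q `^ (k / 2 - 1 / 2) = 1.
  by rewrite -powRD ?qn0 ?implybT // -[RHS](powRr0 q); congr (_ `^ _); ring.
have d1 : 1 - q ^+ 2 * q ^+ 2 ^+ n != 0.
  by rewrite -exprS -exprM subr_eq0 eq_sym lt_eqF // exprn_ilt1 // ltW.
have d2 : qpoch (q ^+ 2) (q ^+ 2) n != 0.
  apply: qpoch_neq0 => i.
  by rewrite -exprS -exprM lt_eqF // exprn_ilt1 // ltW.
rewrite !exprM [q ^+ 2 ^+ n.+1]exprS.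
move: e1 d1 d2; move: (q ^+ 2 ^+ n) (qpoch (q ^+ 2) _ _) (qpoch (q `^ k ^+ 2) _ _) => Q P P'.
move: (q `^ (1 / 2 - k / 2)) (q `^ (k / 2 - 1 / 2)) => a b ab d1 d2.
transitivity (- (q `^ (- n%:R * (k - 1)) * (a * b) * a * P' * (1 - q `^ k ^+ 2 * Q)
   / P / (q + q^-1))).
  move: (q + q^-1)^-1 => iq; by field; rewrite d1 d2.
by rewrite ab; ring.
Qed.

End UnivariateBounds.

(** * Functions of n with a geometric rate in each component *)

Section Domination.
Variables (R : realType) (M : nat).
Implicit Types (b : 'I_M -> R) (f g : {ffun 'I_M -> nat} -> R[i]).

Definition geo_bounded b f : Prop := exists C : R, forall n,
  `|f n| <= (C * \prod_i b i ^+ n i)%:C.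

Lemma geo_bounded_eq b c f g : (forall i, b i = c i) -> (forall n, f n = g n) ->
  geo_bounded b f -> geo_bounded c g.
Proof. by move=> /funext-> /funext->. Qed.

Lemma geo_bounded_mul b c f g : geo_bounded b f -> geo_bounded c g ->
  geo_bounded (fun i => b i * c i) (fun n => f n * g n).
Proof.
move=> [C hC] [D hD]; exists (C * D) => n.
rewrite normrM (_ : C * D * _ = (C * \prod_i b i ^+ n i) * (D * \prod_i c i ^+ n i)).
  by rewrite rmorphM; exact: ler_pM.
rewrite (eq_bigr (fun i => b i ^+ n i * c i ^+ n i)) => [|i _]; last by rewrite exprMn.
by rewrite big_split /=; ring.
Qed.

Lemma geo_bounded_prod b (f : 'I_M -> nat -> R[i]) :
  (forall i, exists C : R, forall a, `|f i a| <= (C * b i ^+ a)%:C) ->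
  geo_bounded b (fun n => \prod_i f i (n i)).
Proof.
move=> /fin_all_exists[C hC]; exists (\prod_i C i) => n.
rewrite normr_prod -big_split rmorph_prod /=; apply: ler_prod => i _.
by rewrite normr_ge0 hC.
Qed.

Lemma geo_bounded_upd b f (i : 'I_M) : geo_bounded b f ->
  geo_bounded b (fun n => f (upd n i (n i).+1)).
Proof.
move=> [C hC]; exists (C * b i) => n; apply: le_trans (hC _) _.
rewrite lecR (bigD1 i) //= [in leRHS](bigD1 i) //= ffunE eqxx exprS !mulrA.
rewrite (eq_bigr (fun l => b l ^+ n l)) // => l /negbTE li.
by rewrite ffunE li.
Qed.

Lemma has_sum_geo_bounded r b f : (forall i, 0 <= b i <= r) -> 0 <= r < 1 ->
  geo_bounded b f -> exists S, has_sum f S.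
Proof.
move=> br /andP[r0 r1] [C hC]; apply: (has_sum_geometric r0 r1 (C := C)) => n.
apply: le_trans (hC n) _; rewrite lecR.
have C0 : 0 <= C.
  have := le_trans (normr_ge0 _) (hC [ffun=> 0%N]).
  by rewrite big1 ?mulr1 ?lecR // => i _; rewrite ffunE expr0.
rewrite ler_wpM2l // ler_prod // => i _; have /andP[b0 ?] := br i.
by rewrite exprn_ge0 //= lerXn2r // nnegrE.
Qed.

End Domination.

(** * Symmetry of Z_+ + Z_- and the recurrence for P_r *)

Section Main.
Variables (R : realType) (q : R).
Hypothesis hq : 0 < q < 1.
Variables (M : nat) (k : 'I_M -> R).
Hypothesis hk : forall i, 0 < k i.
Implicit Types (n x y : {ffun 'I_M -> nat}) (f g : {ffun 'I_M -> nat} -> R[i]) (s t : R).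

Let q0 : 0 < q. Proof. by case/andP: hq. Qed.
Let q1 : q < 1. Proof. by case/andP: hq. Qed.

Let w n : R := \prod_(i < M) weight q (k i) (n i).

Lemma Phi_geo_bounded u s x : geo_bounded
  (fun i => q `^ (height k x s i - complex.Re u + (k i / 2 + 1 / 2)))
  (fun n => Phi q k u s n x).
Proof.
apply: (@geo_bounded_prod _ _ _ (fun i a => phi q u (height k x s i) a (x i) (k i))).
by move=> i; exact: (phi_bound hq).
Qed.

Lemma weight_geo_bounded : geo_bounded (fun i => q `^ (1 - k i)) (fun n => (w n)%:C).
Proof.
have [|C hC] := @geo_bounded_prod R M (fun i => q `^ (1 - k i))
    (fun i a => (weight q (k i) a)%:C).
  move=> i; have [C hC] := weight_bound hq (hk i).
  by exists C => a; rewrite norm_real_complex lecR.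
by exists C => n; have := hC n; rewrite -rmorph_prod.
Qed.

Lemma powR_in01 r : 0 <= r -> 0 <= q `^ r <= 1.
Proof.
move=> r0; rewrite powR_ge0 -[leRHS](powRr0 q) /=.
by apply: ger_powR => //; rewrite q0 ltW.
Qed.

Lemma raise_geo_bounded m (i : 'I_M) :
  geo_bounded (fun=> 1) (fun n => (Wprod q k m n i * raise_coef q (k i) (n i))%:C).
Proof.
have qX a : 0 <= q ^+ a <= 1 by rewrite exprn_ge0 ?exprn_ile1 ?ltW.
have prod01 (a b : R) : 0 <= a <= 1 -> 0 <= b <= 1 -> 0 <= a * b <= 1.
  by move=> /andP[? ?] /andP[? ?]; rewrite mulr_ge0 ?mulr_ile1.
exists (q `^ (1 / 2 - k i / 2) / (q + q^-1)) => n.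
rewrite norm_real_complex lecR big1 => [|l _]; last by rewrite expr1n.
rewrite mulr1 normrM -[leRHS]mul1r; apply: ler_pM => //.
  rewrite /Wprod normr_prod; apply: prodr_ile1 => l _; rewrite normr_ge0 /=.
  have /andP[W0 W1] : 0 <= Wcoef q k n l <= 1.
    by rewrite /Wcoef prod01 // powR_in01 // ltW.
  by rewrite ger0_norm.
have Q0 : 0 < q + q^-1 by rewrite addr_gt0 ?invr_gt0.
rewrite /raise_coef !normrM normrN normfV (gtr0_norm Q0) (ger0_norm (powR_ge0 _ _)).
rewrite ler_pM2r ?invr_gt0 // ler_piMr ?powR_ge0 //.
have /andP[a0 a1] : 0 <= q `^ k i ^+ 2 * q ^+ (2 * n i) <= 1.
  have p := powR_in01 (ltW (hk i)).
  by rewrite expr2; apply: (prod01) => //; exact: prod01.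
by rewrite ger0_norm ?subr_ge0 // gerBl.
Qed.

Variables (s t : R) (v : R[i]).
Hypothesis hv : complex.Re v < 1 + s + t.

(** The product of the rates of the two [Phi] and of the weight; the explicit k_i cancel. *)
Let bnd (i : 'I_M) x y := q `^ (height k x s i + height k y t i + (1 - complex.Re v)).

Lemma bnd_le i x y : 0 <= bnd i x y <= q `^ (1 + s + t - complex.Re v).
Proof.
rewrite powR_ge0 /=; apply: ger_powR; first by rewrite q0 ltW.
have := height_ge hk x s i; have := height_ge hk y t i; lra.
Qed.

(** By [hv] the exponent 1 + s + t - Re v is positive, so the common ratio is below 1. *)
Lemma has_sum_bnd x y f : geo_bounded (fun i => bnd i x y) f -> exists S, has_sum f S.
Proof.
apply: (has_sum_geo_bounded (fun i => bnd_le i x y)); rewrite powR_ge0 /=.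
by rewrite /powR gt_eqF // expR_lt1 pmulr_rlt0 ?ln_lt0 //; move: hv; lra.
Qed.

Let Fn x y n := Phi q k 1 s n x * Phi q k v t n y * (w n)%:C.

Lemma has_sum_Pr x y : has_sum (Fn x y) (Pr q k s t v x y).
Proof.
suff [S hS] : exists S, has_sum (Fn x y) S by rewrite /Pr (has_sum_sum hS).
apply: (@has_sum_bnd x y).
apply: (geo_bounded_eq _ _ (geo_bounded_mul (geo_bounded_mul
  (Phi_geo_bounded 1 s x) (Phi_geo_bounded v t y)) weight_geo_bounded)) => // i.
by rewrite /bnd -!powRD ?(gt_eqF q0) ?implybT //; congr (_ `^ _) => /=; field.
Qed.

(** The subtracted family is T moved one step in component i and extended by 0, so it has the same
    sum. *)
Lemma has_sum_telescope (T : {ffun 'I_M -> nat} -> R[i]) (i : 'I_M) S : has_sum T S ->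
  has_sum (fun n => T n - (if n i == 0%N then 0 else T (upd n i (n i).-1))) 0.
Proof.
move=> hT; rewrite -[X in has_sum _ X](subrr S) -[- S]mulN1r.
rewrite (_ : (fun n => _) = fun n =>
    T n + -1 * (if n i == 0%N then 0 else T (upd n i (n i).-1))).
  apply: has_sumD => //; apply: has_sumZ.
  apply: (@has_sum_reindex _ _ (fun n => upd n i (n i).+1) (fun n => upd n i (n i).-1)).
  - by move=> n; apply/ffunP => l; rewrite !ffunE eqxx; case: eqP => [->|].
  - move=> n /eqP h; case: ifPn => // n0; case: h; apply/ffunP => l.
    by rewrite !ffunE eqxx; case: eqP => // ->; rewrite prednK // lt0n.
  rewrite (_ : (fun n => _) = T) //; apply/funext => n.
  rewrite ffunE eqxx /=; congr T.
  by apply/ffunP => l; rewrite !ffunE; case: eqP => // ->.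
by apply/funext => n; rewrite mulN1r.
Qed.

(** The contribution of component i to w (Z_+ f) g. *)
Let Tr m (i : 'I_M) f g n : R[i] :=
  (w n)%:C * (Wprod q k m n i * raise_coef q (k i) (n i))%:C * f (upd n i (n i).+1) * g n.

(** [weight_raise_lower] turns the shifted term into the contribution of component i to w f (Z_- g);
    [Wprod m n i] involves only earlier components and is unchanged. *)
Lemma Tr_shift m (i : 'I_M) f g n :
  (if n i == 0%N then 0 else Tr m i f g (upd n i (n i).-1)) =
  (w n)%:C * (Wprod q k m n i * lower_coef q (k i) (n i))%:C * f n * g (upd n i (n i).-1).
Proof.
case: eqP => [n0|/eqP n0].
  by rewrite /lower_coef n0 muln0 expr0 subrr !(mulr0, mul0r).
rewrite /Tr -!rmorphM /= ffunE eqxx prednK ?lt0n //.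
have -> : upd (upd n i (n i).-1) i (n i) = n.
  by apply/ffunP => l; rewrite !ffunE; case: eqP => // ->.
congr (_%:C * _ * _).
have -> : Wprod q k m (upd n i (n i).-1) i = Wprod q k m n i.
  apply: eq_bigr => l /andP[_ li]; rewrite /Wcoef ffunE.
  by rewrite -val_eqE /= ltn_eqF.
rewrite /w (bigD1 i) //= [in RHS](bigD1 i) //= ffunE eqxx.
rewrite (eq_bigr (fun l => weight q (k l) (n l))) => [|l /negbTE li]; last by rewrite ffunE li.
have := weight_raise_lower hq (n i).-1 (hk i); rewrite prednK ?lt0n // => e.
set W := \prod_(l < M | l != i) _.
transitivity (W * Wprod q k m n i * (weight q (k i) (n i).-1 * raise_coef q (k i) (n i).-1)).
  by ring.
by rewrite -e; ring.
Qed.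

(** In each component, the telescoping difference for (F, G) pairs Z_+ F with Z_- G, the one for (G,
    F) pairs Z_+ G with Z_- F; subtracting them gives the summand. *)
Lemma has_sum_Zsym m x y : has_sum (fun n =>
   (w n)%:C * (Zplus q k m (fun n => Phi q k 1 s n x) n +
               Zminus q k m (fun n => Phi q k 1 s n x) n) * Phi q k v t n y -
   (w n)%:C * Phi q k 1 s n x * (Zplus q k m (fun n => Phi q k v t n y) n +
               Zminus q k m (fun n => Phi q k v t n y) n)) 0.
Proof.
pose F n := Phi q k 1 s n x; pose G n := Phi q k v t n y.
pose D f g i n := Tr m i f g n -
   (if n i == 0%N then 0 else Tr m i f g (upd n i (n i).-1)).
have gb f g b c i : geo_bounded b f -> geo_bounded c g ->
    (forall i, q `^ (1 - k i) * 1 * b i * c i = bnd i x y) ->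
    has_sum (D f g i) 0.
  move=> hf hg e; have [S hS] : exists S, has_sum (Tr m i f g) S.
    apply: (@has_sum_bnd x y); apply: (geo_bounded_eq e (f := Tr m i f g)) => //.
    apply: geo_bounded_mul => //; apply: geo_bounded_mul; last exact: geo_bounded_upd.
    by apply: geo_bounded_mul; [exact: weight_geo_bounded|exact: raise_geo_bounded].
  exact: has_sum_telescope hS.
have hFG i : has_sum (D F G i) 0.
  apply: (gb _ _ _ _ _ (Phi_geo_bounded 1 s x) (Phi_geo_bounded v t y)) => {}i.
  by rewrite mulr1 /bnd -!powRD ?(gt_eqF q0) ?implybT //; congr (_ `^ _) => /=; field.
have hGF i : has_sum (D G F i) 0.
  apply: (gb _ _ _ _ _ (Phi_geo_bounded v t y) (Phi_geo_bounded 1 s x)) => {}i.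
  by rewrite mulr1 /bnd -!powRD ?(gt_eqF q0) ?implybT //; congr (_ `^ _) => /=; field.
have hD i : has_sum (fun n => D F G i n + -1 * D G F i n) (0 + -1 * 0).
  by apply: has_sumD => //; exact: has_sumZ.
have := @has_sum_sumr _ _ _ (fun i : 'I_M => (m <= i)%N)
   (fun i n => D F G i n + -1 * D G F i n) (fun=> 0 + -1 * 0).
rewrite big1 => [|i _]; last by rewrite mulr0 addr0.
move=> /(_ (fun i _ => hD i)).
congr has_sum; apply/funext => n.
rewrite /Zplus /Zminus -!big_split /= mulr_sumr mulr_suml mulr_sumr -sumrB.
apply: eq_bigr => i _; rewrite /D !Tr_shift /Tr /F /G; ring.
Qed.

Lemma Pr_recurrence x y (j : nat) (ht : -1 < t) :
  qbrace q (height k x s M)%:C *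
    (\sum_(e in Eset M j | admissible y e)
       (Ccoef q k j e y t)%:C * Pr q k s t v x (add_eps y e))
  = qbrace q (height k x s (M - j)%N)%:C * Pr q k s t v x y
    + \sum_(e in Eset M j | admissible y e)
        Dcoef q k v j e y t * Pr q k s t v x (add_eps y e).
Proof.
pose P e := (e \in Eset M j) && admissible y e.
have h1 := @has_sum_sumr _ _ _ P (fun e n => (Ccoef q k j e y t)%:C * Fn x (add_eps y e) n)
  _ (fun e _ => @has_sumZ _ _ _ _ _ (@has_sum_Pr x (add_eps y e))).
have h2 := @has_sum_sumr _ _ _ P (fun e n => Dcoef q k v j e y t * Fn x (add_eps y e) n)
  _ (fun e _ => @has_sumZ _ _ _ _ _ (@has_sum_Pr x (add_eps y e))).
have h3 := @has_sumZ _ _ (qbrace q (height k x s (M - j)%N)%:C) _ _ (@has_sum_Pr x y).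
(* Adding a family of sum zero makes the two sides agree for each n separately. *)
have h4 := has_sumD (has_sumD h3 h2) (@has_sum_Zsym (M - j) x y).
rewrite addr0 in h4; apply: has_sum_unique h4.
have := @has_sumZ _ _ (qbrace q (height k x s M)%:C) _ _ h1.
congr has_sum; apply/funext => n.
set m := (M - j)%N; have mM : (m <= M)%N by exact: leq_subr.
transitivity (qbrace q (height k x s M)%:C * (Phi q k 1 s n x * (w n)%:C) *
  \sum_(e | P e) (Ccoef q k j e y t)%:C * Phi q k v t n (add_eps y e)).
  by rewrite -mulrA mulr_sumr; congr (_ * _); apply: eq_bigr => e _; rewrite /Fn; ring.
rewrite (Ccoef_Phi_sum hq hk) //.
(* For u = 1 the powers q^(u-1) and q^(1-u) are both 1, so Z_+ + Z_- appears. *)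
have := Phi_rec hq hk 1 s n x mM; rewrite subrr !cpow0 // !mul1r => hrec.
rewrite -/m (_ : \prod_(i < M | _) _ = Wprod q k m n M); last first.
  by apply: eq_bigl => i; rewrite ltn_ord andbT.
transitivity ((Wprod q k m n M)%:C * qbrace q (height k x s M)%:C * Phi q k 1 s n x
   * (w n)%:C * Phi q k v t n y); first by ring.
rewrite hrec.
rewrite [X in _ = _ + X + _](_ : _ = (w n)%:C * Phi q k 1 s n x *
   (\sum_(e | P e) Dcoef q k v j e y t * Phi q k v t n (add_eps y e))); last first.
  by rewrite mulr_sumr; apply: eq_bigr => e _; rewrite /Fn; ring.
rewrite (Dcoef_Phi_sum hq hk) // -/m /Fn; ring.
Qed.

End Main.

Theorem corollary4p11 (R : realType) (q : R) (M : nat) (k : 'I_M -> R)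
    (s t : R) (v : R[i]) (x y : {ffun 'I_M -> nat}) (j : nat)
    (hq : 0 < q < 1) (hM : (1 <= M)%N) (hk : forall i, 0 < k i)
    (hs : -1 < s) (ht : -1 < t) (hv : complex.Re v < 1 + s + t)
    (hj : (1 <= j <= M)%N) :
  qbrace q (height k x s M)%:C *
    (\sum_(e in Eset M j | admissible y e)
       (Ccoef q k j e y t)%:C * Pr q k s t v x (add_eps y e))
  = qbrace q (height k x s (M - j)%N)%:C * Pr q k s t v x y
    + \sum_(e in Eset M j | admissible y e)
        Dcoef q k v j e y t * Pr q k s t v x (add_eps y e).
Proof. exact: (Pr_recurrence hq hk hv). Qed.
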